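(* Let $\sigma$ be a type and $\mathcal O$ an antichain of core $\sigma$-structures. Then there exists a finite family $\mathcal D$ of $\sigma$-structures such that $(\mathcal O,\mathcal D)$ is a duality pair if and only if $\mathcal O$ is a regular family of $\sigma$-forests.
   Context: A type $\sigma$ is a finite set of relation symbols with arities; a $\sigma$-structure $\mathbf A$ is a finite set $V(\mathbf A)$ with an $r$-ary relation $R(\mathbf A)$ for each $R\in\sigma$ of arity $r$. Homomorphisms are maps preserving all relations; $\mathbf A\to\mathbf B$ means one exists. The core of $\mathbf A$ is a structure homomorphically equivalent to $\mathbf A$ with the minimum number of vertices (unique up to isomorphism); $\mathbf A$ is a core if it is its own core. A family is an antichain if there is no homomorphism between any two distinct members. A pair $(\mathcal O,\mathcal D)$ of families of $\sigma$-structures is a duality pair if for every $\sigma$-structure $\mathbf A$: $\mathbf A\to\mathbf D$ for some $\mathbf D\in\mathcal D$ iff there is no $\mathbf T\in\mathcal O$ with $\mathbf T\to\mathbf A$. The incidence multigraph $\mathrm{Inc}(\mathbf A)$ is bipartite with parts $V(\mathbf A)$ and the blocks $(R,(x_1,\dots,x_r))$, $(x_1,\dots,x_r)\in R(\mathbf A)$, with an edge joining $x_i$ to the block for each $i$. $\mathbf A$ is a $\sigma$-forest if $\mathrm{Inc}(\mathbf A)$ has no cycles or parallel edges. Let $\mathbb F$ be the set of isomorphism classes of $\sigma$-forests and $\mathbb F_{\mathrm r}$ that of rooted $\sigma$-forests $(\mathbf A,a)$, $a\in V(\mathbf A)$. $(\mathbf A,a)+(\mathbf B,b)$ is the disjoint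 union with $a,b$ identified (new root), $[(\mathbf A,a)]$ forgets the root. For $\mathcal O\subseteq\mathbb F$, $\mathcal O-(\mathbf A,a)=\{(\mathbf B,b)\in\mathbb F_{\mathrm r}:[(\mathbf A,a)+(\mathbf B,b)]\in\mathcal O\}$, and $\mathcal O$ is regular if there are only finitely many distinct sets $\mathcal O-(\mathbf A,a)$, $(\mathbf A,a)\in\mathbb F_{\mathrm r}$. *)

(* Defs.v *)
From Stdlib Require List.
From mathcomp Require Import all_boot.
Set Implicit Arguments. Unset Strict Implicit. Unset Printing Implicit Defensive.

Section Structures.
Variables (sig : finType) (ar : sig -> nat).

Record struct := Struct {
  V : finType;
  rels : forall R : sig, {set (ar R).-tuple V}
}.

Definition is_hom (A B : struct) (f : V A -> V B) : Prop :=
  forall (R : sig) (t : (ar R).-tuple (V A)), t \in rels A R -> map_tuple f t \in rels B R.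

Definition hom (A B : struct) : Prop := exists f : V A -> V B, is_hom f.

Definition iso (A B : struct) : Prop :=
  exists f : V A -> V B, bijective f /\
    forall (R : sig) (t : (ar R).-tuple (V A)), (t \in rels A R) = (map_tuple f t \in rels B R).

(* A sfamily of structures, understood up to isomorphism. *)
Definition sfamily := struct -> Prop.
Definition in_fam (O : sfamily) (A : struct) : Prop := exists B, O B /\ iso A B.

Definition is_core (A : struct) : Prop :=
  forall B : struct, hom A B -> hom B A -> #|V A| <= #|V B|.

Definition antichain (O : sfamily) : Prop :=
  forall A B, O A -> O B -> hom A B -> iso A B.

Definition duality_pair (O : sfamily) (D : seq struct) : Prop :=
  forall A : struct, (exists2 Dm, List.In Dm D & hom A Dm) <-> ~ (exists T, O T /\ hom T A).

(* Incidence multigraph: vertices V A on one side, blocks (R, t) on the other. *)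
Definition inc_vert (A : struct) := (V A + {R : sig & (ar R).-tuple (V A)})%type.

Definition inc_edge (A : struct) : rel (inc_vert A) :=
  fun u w => match u, w with
  | inl x, inr b => (tagged b \in rels A (tag b)) && (x \in tval (tagged b))
  | inr b, inl x => (tagged b \in rels A (tag b)) && (x \in tval (tagged b))
  | _, _ => false
  end.

(* sigma-forest: Inc(A) has no parallel edges (no tuple of a relation repeats an
   entry) and no cycles. *)
Definition is_forest (A : struct) : Prop :=
  (forall (R : sig) (t : (ar R).-tuple (V A)), t \in rels A R -> uniq t) /\
  (forall c : seq (inc_vert A), ucycle (@inc_edge A) c -> size c < 3).

(* (A,a) + (B,b): disjoint union with a and b identified; new root is a. *)
Definition glue_V (A B : struct) (b : V B) : finType :=
  (V A + {y : V B | y != b})%type.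

Definition glue_inB (A B : struct) (a : V A) (b : V B) (y : V B) : glue_V A b :=
  match boolP (y != b) with
  | AltTrue h => inr (exist _ y h)
  | AltFalse _ => inl a
  end.

Definition glue (A : struct) (a : V A) (B : struct) (b : V B) : struct :=
  @Struct (glue_V A b) (fun R =>
    [set map_tuple inl t | t in rels A R] :|:
    [set map_tuple (glue_inB a b) t | t in rels B R]).

Definition residual (O : sfamily) (A : struct) (a : V A) (B : struct) (b : V B) : Prop :=
  is_forest B /\ in_fam O (glue a b).

Definition rooted := {A : struct & V A}.

(* O is regular: the sets O - (A,a), for rooted forests (A,a), take only
   finitely many distinct values, i.e. each equals one of a finite list. *)
Definition regular (O : sfamily) : Prop :=
  exists L : seq rooted,
    (forall p, List.In p L -> is_forest (projT1 p)) /\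
    forall (A : struct) (a : V A), is_forest A ->
      exists p, List.In p L /\
        forall (B : struct) (b : V B),
          residual O a b <-> residual O (projT2 p) b.

End Structures.

(* Main.v *)
Require Import Defs.
From mathcomp Require Import all_boot.
From mathcomp Require Import boolp.
Set Implicit Arguments. Unset Strict Implicit. Unset Printing Implicit Defensive.

(** Forests are used through a cycle-free criterion: for any two positions of a
block, some 2-colouring of the vertices is constant on every other block and
separates these positions.

Given a finite dual [D], a structure [F] belongs to the antichain iff [F] maps to
no member of [D] while every homomorphism [h : T -> F] without a section has a
source [T] mapping to some member of [D].  If [F] had a cycle through a block
[e], linking many copies of [F - e] by instances of [e] that join different
copies at two positions on the cycle would give such a [T] with no map to [D].
For regularity, a rooted forest [(A, a)] is summarised by a finite invariant:
the structures over [A] are recorded only through the sets of values in [D] that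
their roots may take.  Two structures, over the two sides of a gluing, are
combined by pairing their roots in all compatible ways.

Conversely, for a regular family of forests, send a vertex [x] of [X] to the set
of residual classes of rooted forests mapping to [(X, x)].  The finitely many
possible values carry the structure induced by all [X] that contain no
obstruction; a forest mapping there is lifted, branch by branch, to an
equivalent forest mapping to one such [X]. *)

(** * Structures, gluing and forests *)

Section Basics.
Variables (sig : finType) (ar : sig -> nat).
Implicit Types (A B C F T X Y : struct ar).

Lemma map_tuple_comp n (U V W : Type) (g : V -> W) (f : U -> V) (t : n.-tuple U) :
  map_tuple g (map_tuple f t) = map_tuple (g \o f) t.
Proof. by apply: val_inj; rewrite /= -map_comp. Qed.

Lemma eq_map_tuple n (U V : Type) (f g : U -> V) (t : n.-tuple U) :
  (forall i, f (tnth t i) = g (tnth t i)) -> map_tuple f t = map_tuple g t.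
Proof. by move=> fg; apply: eq_from_tnth => i; rewrite !tnth_map fg. Qed.

Lemma map_tuple_id n (U : Type) (f : U -> U) (t : n.-tuple U) :
  (forall i, f (tnth t i) = tnth t i) -> map_tuple f t = t.
Proof. by move=> fg; apply: eq_from_tnth => i; rewrite tnth_map fg. Qed.

Lemma map_tuple_inj n (U V : Type) (f : U -> V) :
  injective f -> injective (fun t : n.-tuple U => map_tuple f t).
Proof. by move=> fI t u /(congr1 val) /= /(inj_map fI) /val_inj. Qed.

Lemma hom_comp A B C (g : V B -> V C) (f : V A -> V B) :
  is_hom g -> is_hom f -> is_hom (g \o f).
Proof. by move=> gh fh R t /fh /gh; rewrite map_tuple_comp. Qed.

Lemma hom_id A : is_hom (id : V A -> V A).
Proof. by move=> R t tA; rewrite map_tuple_id. Qed.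

Lemma hom_trans A B C : hom A B -> hom B C -> hom A C.
Proof. by move=> [f fh] [g gh]; exists (g \o f); apply: hom_comp. Qed.

Lemma iso_hom A B : iso A B -> hom A B.
Proof. by move=> [f [_ fr]]; exists f => R t; rewrite fr. Qed.

Lemma iso_sym A B : iso A B -> iso B A.
Proof.
move=> [f [[g fK gK] fr]]; exists g; split; first by exists f.
by move=> R t; rewrite fr map_tuple_comp map_tuple_id // => i /=; rewrite gK.
Qed.

Lemma iso_refl A : iso A A.
Proof.
exists id; split; first by exists id.
by move=> R t; rewrite map_tuple_id.
Qed.

Lemma iso_trans A B C : iso A B -> iso B C -> iso A C.
Proof.
move=> [f [fb fr]] [g [gb gr]]; exists (g \o f); split; first exact: bij_comp.
by move=> R t; rewrite fr gr map_tuple_comp.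
Qed.

Lemma in_fam_iso (O : sfamily ar) A B : iso A B -> in_fam O A <-> in_fam O B.
Proof.
move=> AB; split=> [[C [OC AC]]|[C [OC BC]]]; exists C; split=> //.
  by apply: iso_trans AC; apply: iso_sym.
exact: iso_trans BC.
Qed.

(** The relations are given apart from [W] because a part keeps only some of the tuples on its
    vertices, and because [U] may be an ambient set that carries no structure. *)
Definition sub_struct (U : finType) (W : {set U})
  (r : forall R : sig, {set (ar R).-tuple U}) : struct ar :=
  @Struct sig ar {v : U | v \in W} (fun R => [set t | map_tuple val t \in r R]).

Lemma sub_structE (U : finType) (W : {set U})
    (r : forall R : sig, {set (ar R).-tuple U}) R (t : (ar R).-tuple {v : U | v \in W}) :
  (t \in rels (sub_struct W r) R) = (map_tuple val t \in r R).
Proof. by rewrite inE. Qed.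

Definition within (U : finType) (W : {set U}) (r : forall R : sig, {set (ar R).-tuple U}) :=
  forall R t, t \in r R -> forall i, tnth t i \in W.

Lemma sub_lift (U : finType) (W : {set U}) n (t : n.-tuple U) :
  (forall i, tnth t i \in W) -> exists t' : n.-tuple {v : U | v \in W}, map_tuple val t' = t.
Proof.
move=> tW; exists [tuple exist _ (tnth t i) (tW i) | i < n].
by apply: eq_from_tnth => i; rewrite tnth_map tnth_mktuple.
Qed.

Lemma val_sub_rels (U : finType) (W : {set U})
    (r : forall R : sig, {set (ar R).-tuple U}) R (t : (ar R).-tuple U) : within W r ->
  t \in r R -> exists2 t', t' \in rels (sub_struct W r) R & map_tuple val t' = t.
Proof.
by move=> wr tr; have [t' t'E] := sub_lift (wr _ _ tr); exists t' => //; rewrite sub_structE t'E.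
Qed.

(** Recognises a gluing inside an ambient set; the decompositions of mixed structures below are all
    instances. *)
Lemma glue_sub_struct A (a : V A) B (b : V B) (U : finType) (W : {set U})
    (r : forall R : sig, {set (ar R).-tuple U}) (f : V A -> U) (g : V B -> U) :
  injective f -> injective g -> f a = g b ->
  (forall v w, f v = g w -> v = a /\ w = b) ->
  (forall u, (u \in W) <-> ((exists v, u = f v) \/ (exists w, u = g w))) ->
  (forall R t, (t \in r R) <-> ((exists2 s, s \in rels A R & t = map_tuple f s) \/
                              (exists2 s, s \in rels B R & t = map_tuple g s))) ->
  iso (glue a b) (sub_struct W r).
Proof.
move=> fI gI fga fg Wcov rcov.
pose h0 (u : V (glue a b)) : U := match u with inl v => f v | inr w => g (val w) end.
have h0W u : h0 u \in W.
  by apply/Wcov; case: u => [v|w] /=; [left; exists v|right; exists (val w)].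
have h0I : injective h0.
  move=> [v|[w wb]] [v'|[w' wb']] //=.
  - by move/fI->.
  - by move/fg => [_ E]; case/eqP: (wb').
  - by move/esym/fg => [_ E]; case/eqP: (wb).
  - by move/gI => E; congr inr; apply: val_inj.
have h0B w : h0 (glue_inB a b w) = g w.
  rewrite /glue_inB; case: {-}_ / boolP => [//|].
  by rewrite negbK => /eqP->.
pose h u : V (sub_struct W r) := exist _ (h0 u) (h0W u).
have hI : injective h by move=> u u' /(congr1 val); apply: h0I.
exists h; split.
  have hsur y : exists u, h u == y.
    case: y => y yW; case/Wcov: (yW) => [[v E]|[w E]].
      by exists (inl v); apply/eqP; apply: val_inj => /=; exact: esym.
    by exists (glue_inB a b w); apply/eqP; apply: val_inj => /=; rewrite h0B -E.
  pose k y := xchoose (hsur y).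
  have hk : cancel k h by move=> y; apply/eqP; apply: (xchooseP (hsur y)).
  by exists k => // u; apply: hI.
move=> R t; rewrite sub_structE map_tuple_comp.
apply/idP/idP => [|/rcov].
  rewrite inE => /orP[] /imsetP[s sR ->]; apply/rcov; [left|right]; exists s => //;
    rewrite map_tuple_comp; apply: eq_map_tuple => i //=.
have hE : injective (val \o h) by move=> u u' /= /h0I.
rewrite inE; case=> [[s sR E]|[s sR E]]; apply/orP; [left|right]; apply/imsetP; exists s => //;
  apply: (map_tuple_inj hE); rewrite E map_tuple_comp; apply: eq_map_tuple => i //=.
Qed.

(** In a forest, [k] can be the indicator of a component of the incidence graph minus the block [t].
    Such colourings pull back along injective homomorphisms by composition. Blocks are compared as
    tagged tuples, since one tuple may lie in two relations. *)
Definition acyc A := forall R (t : (ar R).-tuple (V A)), t \in rels A R ->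
  forall i j, i != j -> exists k : V A -> bool,
    (forall R' (t' : (ar R').-tuple (V A)), t' \in rels A R' ->
       (Tagged (fun R => (ar R).-tuple (V A)) t' : {R & _}) <> Tagged _ t ->
       forall v w, v \in t' -> w \in t' -> k v = k w)
    /\ k (tnth t i) <> k (tnth t j).

Lemma Tagged_map (I : eqType) (U W : Type) (n : I -> nat) (f : U -> W)
    R R' (t : (n R).-tuple U) (t' : (n R').-tuple U) :
  injective f ->
  Tagged (fun R => (n R).-tuple W) (map_tuple f t) = Tagged _ (map_tuple f t') ->
  Tagged (fun R => (n R).-tuple U) t = Tagged _ t'.
Proof.
move=> fI E; move: (congr1 tag E) => /= ER; case: _ / ER t' E => t' E.
congr Tagged; apply: (map_tuple_inj fI).
exact: eq_from_Tagged E.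
Qed.

Lemma acyc_inj A B (f : V A -> V B) : injective f -> is_hom f -> acyc B -> acyc A.
Proof.
move=> fI fh aB R t tA i j ij.
have [k [kc kij]] := aB _ _ (fh _ _ tA) _ _ ij.
exists (k \o f); split; last by move: kij; rewrite !tnth_map.
move=> R' t' t'A nE v w vt wt /=; apply: (kc _ _ (fh _ _ t'A)).
- by move/(Tagged_map fI).
- exact: map_f.
- exact: map_f.
Qed.

(** A path between two positions of a block that avoids the block closes up to a cycle. Conversely,
    a colouring constant on all other blocks stays constant along the rest of a cycle through the
    block. *)
Lemma is_forest_acyc A : is_forest A <-> acyc A.
Proof.
split.
  move=> [uA cA] R t tA i j ij.
  have tI := uA _ _ tA; move/tuple_uniqP: (tI) => {}tI.
  set b0 : {R : sig & (ar R).-tuple (V A)} := Tagged _ t.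
  (* Incidence without the block [b0]; the colour is reachability from position [i]. *)
  pose e : rel (inc_vert A) := fun u w => [&& inc_edge u w, u != inr b0 & w != inr b0].
  exists (fun v => connect e (inl (tnth t i)) (inl v)); split.
    have sub R' (t' : (ar R').-tuple (V A)) v w : t' \in rels A R' ->
       (Tagged (fun R => (ar R).-tuple (V A)) t' : {R & _}) <> Tagged _ t ->
       v \in t' -> w \in t' -> connect e (inl (tnth t i)) (inl v) ->
       connect e (inl (tnth t i)) (inl w).
      move=> t'A nE vt wt /connect_trans; apply.
      set b : {R : sig & (ar R).-tuple (V A)} := Tagged _ t'.
      have bb : (inr b : inc_vert A) != inr b0 by apply/eqP => -[].
      apply: (@connect_trans _ _ (inr b)); apply: connect1; rewrite /e /= bb.
        by rewrite t'A vt.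
      by rewrite t'A wt.
    by move=> R' t' t'A nE v w vt wt; apply/idP/idP; apply: (sub R' t').
  rewrite connect0 => /esym/connectP [p0 pp0 pl0].
  have [p' [pp pu pl]] : exists p', [/\ path e (inl (tnth t i)) p',
        uniq (inl (tnth t i) :: p') & inl (tnth t j) = last (inl (tnth t i)) p'].
    by rewrite pl0; case: (shortenP pp0) => p' pp' pu _; exists p'.
  have xy : tnth t i != tnth t j by apply: contra_neq ij => /tI.
  have p2 : 0 < size p' by case: (p') pl => //= -[E]; rewrite E eqxx in xy.
  have b0p : inr b0 \notin (inl (tnth t i) :: p' : seq (inc_vert A)).
    rewrite inE /=; clear pl p2 pu; elim: p' (inl _) pp => //= u p' IH x /andP[/and3P[_ _ ub] pp].
    by rewrite inE negb_or eq_sym ub (IH u).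
  suff /cA : ucycle (@inc_edge _ _ A) (inr b0 :: inl (tnth t i) :: p').
    by rewrite /= !ltnS leqNgt p2.
  rewrite /ucycle cons_uniq b0p pu andbT.
  rewrite /= rcons_path -pl /= tA !mem_tnth /= !andbT.
  apply: sub_path pp => u w; by case/and3P.
move=> aA; split=> [R t tA|c].
  apply/tuple_uniqP => i j E; apply/eqP; apply/negP => /negP ij.
  by have [k [_]] := aA _ _ tA _ _ ij; rewrite E.
(* The bound 3 admits only the empty cycle and an edge traversed back and forth. A longer cycle
   contains a block, which is rotated to the front. *)
move=> cc; rewrite ltnNge; apply/negP => c3.
have [b bc] : exists b, inr b \in c.
  case: c cc c3 => [//|[x|b] [|w c]] // /andP[cc _] _; last by exists b; rewrite inE eqxx.
  case: w cc => [y|b] /=; first by [].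
  by exists b; rewrite !inE eqxx orbT.
have [k q E] := rot_to bc.
have: size (inr b :: q) = size c by rewrite -E size_rot.
have: ucycle (@inc_edge _ _ A) (inr b :: q) by rewrite -E rot_ucycle.
case: q {E} => [|u q] /andP[cq uq] sq; first by rewrite -sq in c3.
case: q cq uq sq => [|u' q] cq uq sq; first by rewrite -sq in c3.
move: cq uq; rewrite /= rcons_path {sq}.
case: u => [x|//] /= /andP[/andP[bA xb] /andP[e1 /andP[pq el]]] /andP[bq /andP[xq _]].
move: el; have: last u' q \in u' :: q by apply: mem_last.
case El: (last u' q) => [y|//] yq /andP[_ yb].
have xy : x != y by apply: contraNneq xq => ->.
have [i xE] := tnthP _ _ xb; have [j yE] := tnthP _ _ yb.
have ij : i != j by apply: contraNneq xy => ij; rewrite xE yE ij.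
case: b bc bA xb bq yb i j xE yE ij => [R t] /= _ tA xb bq yb i j xE yE ij.
have [kap [kc]] := aA _ _ tA _ _ ij; rewrite -xE -yE.
(* The colour of [x] propagates along the cycle up to [y], the other neighbour of the block. *)
pose P (w : inc_vert A) := match w with inl v => kap v = kap x
   | inr b' => forall v, v \in tagged b' -> kap v = kap x end.
suff: P (last (inl x) (u' :: q)) by rewrite [last _ _]/= El /= => ->.
have: P (inl x) by [].
have: path (@inc_edge _ _ A) (inl x) (u' :: q) by rewrite [path _ _ _]/= e1 pq.
have: inr (Tagged (fun R => (ar R).-tuple (V A)) t) \notin (u' :: q).
  by move: bq; rewrite !inE /=.
elim: (u' :: q) (inl x : inc_vert A) => [//|w s IH] z.
rewrite inE negb_or => /andP[wb ws] /=/andP[zw pw] Pz; apply: (IH w) => //.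
case: z w zw Pz wb {IH ws pw} => [v|b'] [w|b''] //= /andP[b'A vb] Pz wb; last exact: Pz.
move=> v' v'b; rewrite -Pz; case: b'' b'A vb wb v'b => R' t' /= t'A vb wb v'b.
apply: (kc R' t') => //; move=> E; move/eqP: wb; apply; congr inr; exact: esym.
Qed.

Lemma acyc_sub A (W : {set V A}) (r : forall R : sig, {set (ar R).-tuple (V A)}) :
  (forall R t, t \in r R -> t \in rels A R) ->
  acyc A -> acyc (sub_struct W r).
Proof.
move=> rA; apply: (@acyc_inj (sub_struct W r) A val); first exact: val_inj.
by move=> R t; rewrite sub_structE => /rA.
Qed.

End Basics.

(** * Cores; a finite dual forces forests *)

Section Cores.
Variables (sig : finType) (ar : sig -> nat).
Implicit Types (A B C F T X Y : struct ar).

(** The image of [f] is equivalent to [F], so minimality makes [f] injective; then [f] permutes the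
    finite set of tuples of each relation. *)
Lemma core_endo F (f : V F -> V F) : is_core F -> is_hom f ->
  injective f /\ forall R (t : (ar R).-tuple (V F)), map_tuple f t \in rels F R -> t \in rels F R.
Proof.
move=> cF fh.
pose W := [set f v | v : V F]; pose B := sub_struct W (rels F).
have fW v : f v \in W by apply: imset_f.
have FB : hom F B.
  exists (fun v => exist _ (f v) (fW v)) => R t tF.
  by rewrite sub_structE map_tuple_comp; apply: fh.
have BF : hom B F by exists val => R t; rewrite sub_structE.
have fI : injective f.
  have: #|W| == #|V F|.
    by rewrite eqn_leq leq_imset_card; have := cF B FB BF; rewrite card_sig.
  by move/imset_injP => I x y; apply: I.
split=> // R t tF.
have: [set map_tuple f t | t : (ar R).-tuple (V F) in rels F R] == rels F R.
  rewrite eqEcard card_imset ?leqnn ?andbT; last exact: map_tuple_inj.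
  by apply/subsetP => _ /imsetP[s sF ->]; apply: fh.
by move/eqP => E; move: tF; rewrite -{1}E => /imsetP[s sF] /(map_tuple_inj fI) ->.
Qed.

(** Composing [h] with a homomorphism back gives an endomorphism of the core; its inverse corrects
    that homomorphism into a section. *)
Lemma core_section F T (h : V T -> V F) : is_core F -> is_hom h -> hom F T ->
  exists s : V F -> V T, is_hom s /\ cancel s h.
Proof.
move=> cF hh [s0 s0h].
have [eI er] := core_endo cF (hom_comp hh s0h).
have [k ek ke] := injF_bij eI.
exists (s0 \o k); split=> // R t tF.
rewrite -map_tuple_comp; apply: s0h; apply: er.
by rewrite map_tuple_comp map_tuple_id // => i; apply: ke.
Qed.

Lemma core_iso F T : is_core F -> is_core T -> hom F T -> hom T F -> iso F T.
Proof.
move=> cF cT [f fh] [g gh].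
have [I r] := core_endo cF (hom_comp gh fh).
have fI : injective f by move=> x y E; apply: I; rewrite /= E.
exists f; split.
  by apply: inj_card_bij fI _; apply: cT; [exists g|exists f].
move=> R t; apply/idP/idP; first exact: fh.
by move/gh; rewrite map_tuple_comp; apply: r.
Qed.

Lemma core_of_iso A B : iso A B -> is_core A -> is_core B.
Proof.
move=> AB cA C BC CB.
have [f [[g fK gK] _]] := AB.
apply: leq_trans (cA C _ _); first exact: leq_card (can_inj gK).
  exact: hom_trans (iso_hom AB) BC.
by apply: hom_trans CB _; apply/iso_hom/iso_sym.
Qed.

End Cores.

(** * Membership in the antichain read off from the dual *)

Section Dual.
Variables (sig : finType) (ar : sig -> nat) (O : sfamily ar).
Implicit Types (A B C F T X Y : struct ar).
Hypotheses (acO : antichain O) (coreO : forall A, O A -> is_core A).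
Variables (m : nat) (D : 'I_m -> struct ar).
Definition obstr T := forall j, ~ hom T (D j).
Hypothesis dual : forall A, obstr A <-> exists T, O T /\ hom T A.

(** If an obstruction [T] maps to a member [F], the member of [O] below [T] is isomorphic to [F] by
    the antichain condition, so [F] maps to [T] and [core_section] applies. Conversely some [G] in
    [O] maps to [F]; a section makes them equivalent, and sections of the maps from structures
    equivalent to [F] show that [F] is a core. *)
Lemma in_fam_obstr F : in_fam O F <->
  obstr F /\ forall T (h : V T -> V F), is_hom h -> obstr T ->
    exists s : V F -> V T, is_hom s /\ cancel s h.
Proof.
split=> [[G [OG FG]]|[oF sF]].
  split; first by apply/dual; exists G; split=> //; apply/iso_hom/iso_sym.
  move=> T h hh /dual[G' [OG' G'T]].
  have TF : hom T F by exists h.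
  have /(acO OG' OG) G'G : hom G' G by apply: hom_trans (iso_hom FG); apply: hom_trans TF.
  apply: core_section => //; first by apply: core_of_iso (iso_sym FG) _; apply: coreO.
  by apply: hom_trans (iso_hom FG) _; apply: hom_trans G'T; apply/iso_hom/iso_sym.
have [G [OG [h hh]]] := (dual F).1 oF.
have oG : obstr G by apply/dual; exists G; split=> //; exists id; apply: hom_id.
have [s [sh sK]] := sF _ _ hh oG.
exists G; split=> //; apply: core_iso; [|exact: coreO|by exists s|by exists h].
move=> B FB [q qh].
have oB : obstr B by move=> j BD; apply: (oF j); apply: hom_trans BD.
have [s' [_ s'K]] := sF _ _ qh oB.
exact: leq_card (can_inj s'K).
Qed.

(* If the positions [i], [j] of a block [e] lie on a cycle, copies of [G] minus
   [e] are linked by instances of [e] using different copies at [i] and [j]: by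
   pigeonhole this obstructs every dual, and a section would pick one copy. *)
Section Unwind.
Variables (G : struct ar) (R0 : sig) (t0 : (ar R0).-tuple (V G)) (i j : 'I_(ar R0)) (n : nat).

Definition unwind : struct ar :=
  @Struct sig ar (V G * 'I_n.+1)%type (fun R => [set t |
    (map_tuple fst t \in rels G R) &&
    (if (Tagged (fun R => (ar R).-tuple (V G)) (map_tuple fst t) : {R : sig & _}) == Tagged _ t0
     (* Here [R] equals [R0] only by the test, so the positions are read with [nth]; its default is
        not reached in this branch. *)
     then nth ord0 (map snd t) i != nth ord0 (map snd t) j
     else [forall p, forall q, (tnth t p).2 == (tnth t q).2])]).

Lemma nth_map_snd (U : Type) k (t : k.-tuple (U * 'I_n.+1)) (p : 'I_k) :
  nth ord0 (map snd t) p = (tnth t p).2.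
Proof. by rewrite -tnth_map (tnth_nth ord0). Qed.

Lemma unwind_hom : is_hom (fst : V unwind -> V G).
Proof. by move=> R t; rewrite inE => /andP[]. Qed.

Lemma unwind_same R (t : (ar R).-tuple (V G)) c : t \in rels G R ->
  (Tagged (fun R => (ar R).-tuple (V G)) t : {R : sig & _}) != Tagged _ t0 ->
  map_tuple (fun v => (v, c)) t \in rels unwind R.
Proof.
move=> tG te; rewrite inE map_tuple_comp map_tuple_id // tG (negbTE te) /=.
by apply/forallP => p; apply/forallP => q; rewrite !tnth_map.
Qed.

Lemma unwind_diff c c' : t0 \in rels G R0 -> i != j -> c != c' ->
  [tuple (tnth t0 p, if p == i then c else c') | p < ar R0] \in rels unwind R0.
Proof.
move=> tG ij cc; rewrite inE.
have -> : map_tuple fst [tuple (tnth t0 p, if p == i then c else c') | p < ar R0] = t0.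
  by apply: eq_from_tnth => p; rewrite tnth_map tnth_mktuple.
rewrite tG eqxx andTb !nth_map_snd !tnth_mktuple /= eqxx.
by rewrite [j == i]eq_sym (negbTE ij).
Qed.

(** Two of the [n.+1] copies carry the same map to [E]. An instance of [t0] joining them shows that
    this map preserves [t0]; every other tuple is preserved within one copy. *)
Lemma unwind_pigeonhole (E : struct ar) : t0 \in rels G R0 -> i != j ->
  #|{ffun V G -> V E}| <= n -> hom unwind E -> hom G E.
Proof.
move=> tG ij En [f fh].
pose F (c : 'I_n.+1) : {ffun V G -> V E} := [ffun v => f (v, c)].
have [c [c' cc FE]] : exists c, exists2 c', c != c' & F c = F c'.
  apply/injectivePn/negP => /injectiveP /leq_card.
  by rewrite card_ord ltnNge En.
exists (F c) => R t tR.
have [Te|te] := eqVneq (Tagged (fun R => (ar R).-tuple (V G)) t : {R : sig & _}) (Tagged _ t0).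
  move: (congr1 tag Te) => /= RE; case: _ / (esym RE) t tR Te => t tR Te.
  rewrite (eq_from_Tagged Te).
  have <- : map_tuple f [tuple (tnth t0 p, if p == i then c else c') | p < ar R0]
           = map_tuple (F c) t0.
    apply: eq_from_tnth => p; rewrite !tnth_map !tnth_ord_tuple.
    by case: (p == i); [|rewrite FE]; rewrite ffunE.
  exact/fh/unwind_diff.
have <- : map_tuple f (map_tuple (fun v => (v, c)) t) = map_tuple (F c) t.
  by rewrite map_tuple_comp; apply: eq_map_tuple => p; rewrite ffunE.
exact/fh/unwind_same.
Qed.

(** The colour tells whether the section uses the same copy as at position [i]: other blocks stay in
    one copy, while [t0] changes copy between [i] and [j]. *)
Lemma unwind_section (s : V G -> V unwind) : t0 \in rels G R0 ->
  is_hom s -> cancel s fst ->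
  exists k : V G -> bool,
    (forall R' (t' : (ar R').-tuple (V G)), t' \in rels G R' ->
       (Tagged (fun R => (ar R).-tuple (V G)) t' : {R & _}) <> Tagged _ t0 ->
       forall v w, v \in t' -> w \in t' -> k v = k w)
    /\ k (tnth t0 i) <> k (tnth t0 j).
Proof.
move=> tG sh sK.
have fs R (t : (ar R).-tuple (V G)) : map_tuple fst (map_tuple s t) = t.
  by rewrite map_tuple_comp map_tuple_id => // p; apply: sK.
exists (fun v => (s v).2 == (s (tnth t0 i)).2); split.
  move=> R t tR /eqP te _ _ /tnthP[p ->] /tnthP[q ->].
  have := sh _ _ tR; rewrite inE fs tR (negbTE te) /= => /forallP/(_ p)/forallP/(_ q).
  by rewrite !tnth_map => /eqP->.
have := sh _ _ tG; rewrite inE fs tG !eqxx /=.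
rewrite !nth_map_snd !tnth_map => ne.
by move/esym; apply/negP; rewrite eq_sym.
Qed.

End Unwind.

Lemma dual_forest G : O G -> is_forest G.
Proof.
move=> OG; apply/is_forest_acyc => R t tG i j ij.
(* Large enough for the pigeonhole argument against every dual at once. *)
pose n := \sum_k #|{ffun V G -> V (D k)}|.
have oG : obstr G by apply/dual; exists G; split=> //; exists id; apply: hom_id.
have oU : obstr (unwind t i j n).
  move=> k /(unwind_pigeonhole tG ij) GD; apply: (oG k); apply: GD.
  by rewrite /n (bigD1 k) //= leq_addr.
have /in_fam_obstr[_ /(_ _ _ (@unwind_hom _ _ _ i j n) oU) [s [sh sK]]] : in_fam O G.
  by exists G; split=> //; apply: iso_refl.
exact: (unwind_section tG sh sK).
Qed.

End Dual.

(** * A finite dual forces regularity *)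

Section GlueFacts.
Variables (sig : finType) (ar : sig -> nat).
Implicit Types (A B C F T X Y : struct ar).

Lemma glue_inB_root A (a : V A) B (b : V B) : glue_inB a b b = inl a.
Proof. by rewrite /glue_inB; case: {-}_ / boolP => // h; case/eqP: (h). Qed.

Lemma glue_inB_val A (a : V A) B (b : V B) (w : {y : V B | y != b}) :
  glue_inB a b (val w) = inr w.
Proof.
rewrite /glue_inB; case: {-}_ / boolP => [h|].
  by congr inr; apply: val_inj.
by rewrite (valP w).
Qed.

Lemma glue_inB_neq A (a : V A) B (b : V B) w (wb : w != b) :
  glue_inB a b w = inr (exist _ w wb).
Proof. exact: glue_inB_val (exist _ w wb). Qed.

Lemma glue_inB_inl A (a : V A) B (b : V B) w v : glue_inB a b w = inl v -> v = a /\ w = b.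
Proof.
rewrite /glue_inB; case: {-}_ / boolP => [//|].
by rewrite negbK => /eqP-> [->].
Qed.

Lemma hom_inl A (a : V A) B (b : V B) : is_hom (inl : V A -> V (glue a b)).
Proof. by move=> R t tA; rewrite inE; apply/orP; left; apply: imset_f. Qed.

Lemma hom_inB A (a : V A) B (b : V B) : is_hom (glue_inB a b : V B -> V (glue a b)).
Proof. by move=> R t tA; rewrite inE; apply/orP; right; apply: imset_f. Qed.

Definition glue_fun A (a : V A) B (b : V B) (U : Type) (f : V A -> U) (g : V B -> U)
    (u : V (glue a b)) : U :=
  match u with inl v => f v | inr w => g (val w) end.

Lemma glue_fun_inB A (a : V A) B (b : V B) (U : Type) (f : V A -> U) (g : V B -> U) w :
  f a = g b -> glue_fun f g (glue_inB a b w : V (glue a b)) = g w.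
Proof.
move=> fg; have [->|wb] := eqVneq w b; first by rewrite glue_inB_root.
by rewrite glue_inB_neq.
Qed.

Lemma glue_fun_hom A (a : V A) B (b : V B) F (f : V A -> V F) (g : V B -> V F) :
  is_hom f -> is_hom g -> f a = g b -> is_hom (glue_fun f g : V (glue a b) -> V F).
Proof.
move=> fh gh fg R t; rewrite inE => /orP[] /imsetP[s sR ->]; rewrite map_tuple_comp.
  exact: fh.
rewrite (@eq_map_tuple _ _ _ _ g); first exact: gh.
by move=> i /=; apply: glue_fun_inB.
Qed.

Lemma glue_P A (a : V A) B (b : V B) R (t : (ar R).-tuple (V (glue a b))) :
  t \in rels (glue a b) R ->
  (exists2 s, s \in rels A R & t = map_tuple inl s) \/
  (exists2 s, s \in rels B R & t = map_tuple (glue_inB a b) s).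
Proof.
by rewrite inE => /orP[] /imsetP[s sR ->]; [left|right]; exists s.
Qed.

(** In a forest these are the blocks with all entries equal to [x], nullary blocks included; at a
    root, they are the only ones that both sides of a gluing can share. *)
Definition lab T (x : V T) : {set sig} :=
  [set R : sig | (ar R <= 1) && (nseq_tuple (ar R) x \in rels T R)].

Lemma acyc_const A (a : V A) R (t : (ar R).-tuple (V A)) : acyc A -> t \in rels A R ->
  (forall p, tnth t p = a) -> t = nseq_tuple (ar R) a /\ R \in lab a.
Proof.
move=> aA tA ta.
have tE : t = nseq_tuple (ar R) a by apply: eq_from_tnth => p; rewrite ta tnth_nseq.
split=> //; rewrite inE -tE tA andbT leqNgt; apply/negP => R1.
pose p := Ordinal (ltnW R1); pose q := Ordinal R1.
by have [//|k [_]] := aA _ _ tA p q; rewrite !ta.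
Qed.

End GlueFacts.

(** * The finite invariant of a rooted structure *)

Section Invariant.
Variables (sig : finType) (ar : sig -> nat) (O : sfamily ar).
Implicit Types (A B C F T X Y : struct ar).
Hypotheses (acO : antichain O) (coreO : forall A, O A -> is_core A).
Variables (m : nat) (D : 'I_m -> struct ar).
Hypothesis dual : forall A, obstr D A <-> exists T, O T /\ hom T A.

Let W : finType := {j : 'I_m & V (D j)}.
Let tg j (d : V (D j)) : W := Tagged (fun j => V (D j)) d.
Let colour := (bool * {set sig} * {set W})%type.

Lemma tg_inj j : injective (@tg j).
Proof. by move=> d d' E; apply: eq_from_Tagged E. Qed.

(* Each root may take any value in its set, as it will be paired with many
   roots on the other side of the gluing. *)
Definition colourable A (a : V A) T (h : V T -> V A) (mk : V T -> bool)
    (j : 'I_m) (C : {set colour}) : Prop :=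
  exists S : V T -> {set W},
  [/\ forall v, h v != a -> exists d : V (D j), tg d \in S v,
      forall x, h x = a -> (mk x, lab x, S x) \in C
    & forall R (t : (ar R).-tuple (V T)), t \in rels T R ->
       forall d : (ar R).-tuple (V (D j)), (forall p, tg (tnth d p) \in S (tnth t p)) ->
       d \in rels (D j) R].

Definition colset A (a : V A) T (h : V T -> V A) (mk : V T -> bool) : {set 'I_m * {set colour}} :=
  [set p | `[< colourable a h mk p.1 p.2 >]].

(** A mark is a promise that no section of [h] passes through the root; it is all that is remembered
    about sections over [A]. *)
Definition marked A (a : V A) T (h : V T -> V A) (mk : V T -> bool) : Prop :=
  is_hom h /\ forall x, h x = a -> mk x ->
    ~ exists s : V A -> V T, [/\ is_hom s, cancel s h & s a = x].

(** The values lie in a finite type. The second component controls the maps from gluings to the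
    duals; the third lists what the duals see of all marked structures over [A], so that these can
    be exchanged between rooted structures with equal invariants. *)
Definition invariant A (a : V A) : {set sig} * {set W} * {set {set 'I_m * {set colour}}} :=
  (lab a,
   [set w : W | `[< exists f : V A -> V (D (tag w)), is_hom f /\ f a = tagged w >]],
   [set c | `[< exists T (h : V T -> V A) mk, marked a h mk /\ c = colset a h mk >]]).

(** * Exchanging one side of a gluing *)

Section Transfer.
Variables (A : struct ar) (a : V A) (A' : struct ar) (a' : V A') (B : struct ar) (b : V B).
Hypotheses (acA : acyc A) (acB : acyc B).
Hypothesis labE : lab a = lab a'.
Variables (T : struct ar) (h : V T -> V (glue a' b)).
Hypothesis hh : is_hom h.

Definition is_inl (u : V (glue a' b)) := if u is inl _ then true else false.

Definition liftA (y : V T) : Prop :=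
  exists s : V A' -> V T, [/\ is_hom s, forall v, h (s v) = inl v & s a' = y].
Definition mkT (y : V T) : bool := ~~ `[< liftA y >].

(** Tuples are selected by their image, not by their vertices, so that a block at the root coming
    only from [B] is left out. *)
Definition partA : struct ar := sub_struct [set v | is_inl (h v)]
  (fun R => [set t in rels T R | [exists s in rels A' R, map_tuple h t == map_tuple inl s]]).
Definition hA' (v : V partA) : V A' := match h (val v) with inl w => w | inr _ => a' end.

Lemma hA'E v : h (val v) = inl (hA' v).
Proof. by case: v => v vP; rewrite /hA' /=; move: vP; rewrite inE; case: (h v). Qed.

Lemma marked_partA : marked a' hA' (mkT \o val).
Proof.
split=> [R t|x _ /= mx [s [sh sK sx]]].
  rewrite sub_structE inE => /andP[_ /existsP[s /andP[sA /eqP E]]].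
  suff -> : map_tuple hA' t = s by [].
  apply: eq_from_tnth => p; have := congr1 (fun t => tnth t p) E.
  by rewrite !tnth_map hA'E => -[].
move: mx; rewrite /mkT; apply/negP; rewrite negbK; apply/asboolP.
exists (val \o s); split=> [R t /sh| v | /=]; last by rewrite sx.
  by rewrite sub_structE inE -map_tuple_comp => /andP[].
by rewrite /= hA'E sK.
Qed.

Definition labT (y : V T) : {set sig} :=
  [set R : sig | [&& ar R <= 1, nseq_tuple (ar R) y \in rels T R & R \in lab a']].

Lemma lab_partA (x : V partA) : hA' x = a' -> lab x = labT (val x).
Proof.
move=> xa; apply/setP => R; rewrite !inE; case: leqP => //= R1.
have -> : map_tuple val (nseq_tuple (ar R) x) = nseq_tuple (ar R) (val x).
  by apply: eq_from_tnth => p; rewrite tnth_map !tnth_nseq.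
case: (_ \in rels T R) => //=.
have hE : map_tuple h (nseq_tuple (ar R) (val x)) = map_tuple inl (nseq_tuple (ar R) a').
  by apply: eq_from_tnth => p; rewrite !tnth_map !tnth_nseq hA'E xa.
apply/existsP/idP => [[s /andP[sA]]|aR]; last by exists (nseq_tuple (ar R) a'); rewrite aR hE /=.
rewrite hE => /eqP/(map_tuple_inj _) E; rewrite E //.
by move=> u v [].
Qed.

Variables (TA : struct ar) (hA : V TA -> V A) (mkA : V TA -> bool).
Hypothesis mA : marked a hA mkA.

Let V0 : finType := (V TA + V T + V TA * V T)%type.

Definition projA (u : V0) : option (V TA) :=
  match u with inl (inl t) => Some t | inl (inr _) => None | inr (x, _) => Some x end.
Definition projT (u : V0) : option (V T) :=
  match u with inl (inl _) => None | inl (inr v) => Some v | inr (_, y) => Some y end.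

Definition starV : {set V0} := [set u | match u with
  | inl (inl t) => hA t != a
  | inl (inr v) => ~~ is_inl (h v)
  | inr (x, y) => [&& hA x == a, h y == inl a', mkA x == mkT y & lab x == labT y] end].

(** A tuple constrains only one projection, so each entry at a root chooses its partner freely. The
    sets of values in [colourable] record this freedom. *)
Definition star : struct ar := sub_struct starV (fun R => [set t |
  [exists s in rels TA R, map_tuple projA t == map_tuple Some s] ||
  [exists s in rels T R, (map_tuple h s \in [set map_tuple (glue_inB a' b) w | w in rels B R])
                         && (map_tuple projT t == map_tuple Some s)]]).

Definition in_star u (uS : u \in starV) : V star := exist _ u uS.

Definition hstar (u : V star) : V (glue a b) :=
  match val u with
  | inl (inl t) => inl (hA t)
  | inl (inr v) => match h v with inl _ => inl a | inr q => inr q end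
  | inr _ => inl a end.

Lemma star_P R (t : (ar R).-tuple (V star)) : t \in rels star R <->
  (exists2 s, s \in rels TA R & forall p, projA (val (tnth t p)) = Some (tnth s p)) \/
  (exists s w, [/\ s \in rels T R, w \in rels B R,
     forall p, h (tnth s p) = glue_inB a' b (tnth w p)
     & forall p, projT (val (tnth t p)) = Some (tnth s p)]).
Proof.
rewrite sub_structE inE; split.
  case/orP => /existsP[s]; [case/andP=> sR /eqP E; left; exists s => // p|].
    by have := congr1 (fun t => tnth t p) E; rewrite !tnth_map.
  case/and3P => sR /imsetP[w wB E1] /eqP E; right; exists s, w; split=> // p.
    by have := congr1 (fun t => tnth t p) E1; rewrite !tnth_map.
  by have := congr1 (fun t => tnth t p) E; rewrite !tnth_map.
case=> [[s sR sE]|[s [w [sR wB sw sE]]]]; apply/orP; [left|right]; apply/existsP; exists s;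
  rewrite sR /=.
  by apply/eqP/eq_from_tnth => p; rewrite !tnth_map sE.
apply/andP; split; last by apply/eqP/eq_from_tnth => p; rewrite !tnth_map sE.
apply/imsetP; exists w => //.
by apply/eq_from_tnth => p; rewrite !tnth_map.
Qed.

Lemma hstar_A (u : V star) t v : projA (val u) = Some t -> hstar u = v -> v = inl (hA t).
Proof.
case: u => -[[t'|v']|[x y]] uS; rewrite /hstar //= => -[<-] <- //.
by move: uS; rewrite inE => /andP[/eqP->].
Qed.

Lemma hstar_T (u : V star) v w : projT (val u) = Some v -> h v = glue_inB a' b w ->
  hstar u = glue_inB a b w.
Proof.
case: u => -[[t'|v']|[x y]] uS; rewrite /hstar //= => -[<-] {v}.
  move: uS; rewrite inE; case E: (h v') => [//|q] _.
  have [->|wb] := eqVneq w b; first by rewrite glue_inB_root.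
  by rewrite !glue_inB_neq => -[->].
move: uS; rewrite inE => /and4P[_ /eqP-> _ _] /esym/glue_inB_inl[_ ->].
by rewrite glue_inB_root.
Qed.

Lemma star_hom : is_hom hstar.
Proof.
move=> R t /star_P[[s sR sE]|[s [w [sR wB sw sE]]]].
  suff -> : map_tuple hstar t = map_tuple inl (map_tuple hA s) by apply/hom_inl/(mA.1).
  by apply: eq_from_tnth => p; rewrite !tnth_map; apply: hstar_A (sE p) _.
suff -> : map_tuple hstar t = map_tuple (glue_inB a b) w by apply/hom_inB.
by apply: eq_from_tnth => p; rewrite !tnth_map; apply: hstar_T (sE p) _.
Qed.

Lemma star_inl (u : V star) v : hstar u = inl v -> exists2 t, projA (val u) = Some t & hA t = v.
Proof.
case: u => -[[t'|v']|[x y]] uS; rewrite /hstar /=.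
- by case=> <-; exists t'.
- by move: uS; rewrite inE; case: (h v').
- by case=> <-; exists x => //; move: uS; rewrite inE => /andP[/eqP].
Qed.

Lemma star_inB (u : V star) w : hstar u = glue_inB a b w ->
  exists2 v, projT (val u) = Some v & h v = glue_inB a' b w.
Proof.
case: u => -[[t'|v']|[x y]] uS; rewrite /hstar /=.
- move/esym/glue_inB_inl => [E _]; by move: uS; rewrite inE E eqxx.
- move: uS; rewrite inE => uS E; exists v' => //; move: uS E.
  case: (h v') => [//|q] _ E.
  have [wb|wb] := eqVneq w b; first by move: E; rewrite wb glue_inB_root.
  by move: E; rewrite !glue_inB_neq => -[->].
- move/esym/glue_inB_inl => [_ ->]; exists y => //; rewrite glue_inB_root.
  by move: uS; rewrite inE => /and4P[_ /eqP].
Qed.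

Lemma star_root (u : V star) t v : projA (val u) = Some t -> projT (val u) = Some v ->
  [/\ val u = inr (t, v), hstar u = inl a, mkA t = mkT v & lab t = labT v].
Proof.
case: u => -[[t'|v']|[x y]] uS //= [<-] [<-]; split=> //.
  by move: uS; rewrite inE => /and4P[_ _ /eqP].
by move: uS; rewrite inE => /and4P[_ _ _ /eqP].
Qed.

(** The section sends the root to a pair [(x, y)]. If [x] were marked, restricting to [A] would give
    a section through [x]. So [y] is unmarked and has a lift over [A'], which is glued to the
    restriction to [B]. *)
Lemma star_section : (exists s, is_hom s /\ cancel s hstar) ->
  exists s : V (glue a' b) -> V T, is_hom s /\ cancel s h.
Proof.
case=> s [sh sK].
have [x xA _] := star_inl (sK (inl a)).
have [y yT hy] := star_inB (etrans (sK (inl a)) (esym (glue_inB_root a b))).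
have [uE _ mE lE] := star_root xA yT.
have [mx|nmx] := boolP (mkA x).
  have hx : hA x = a by have := hstar_A xA (sK _) => -[].
  case: (mA.2 _ hx mx).
  have /choice[sA sAP] : forall v, exists t, projA (val (s (inl v))) = Some t /\ hA t = v.
    move=> v.
    by have [w] := star_inl (sK (inl v)); exists w.
  have sAa : sA a = x by have := (sAP a).1; rewrite xA => -[].
  exists sA; split=> // [R t tA|v]; last exact: (sAP v).2.
  (* The image tuple may come from [T] over [B]. Then its entries are all roots, and the equal
     labels of [x] and [y] supply the tuple of [TA]. *)
  have /star_P := sh _ _ (hom_inl a b tA).
  case=> [[t0 t0R t0E]|[t0 [w [t0R wB t0w t0E]]]].
    suff -> : map_tuple sA t = t0 by [].
    apply: eq_from_tnth => p; have := t0E p.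
    by rewrite !tnth_map (sAP _).1 => -[].
  have ta p : tnth t p = a.
    have E := t0E p; rewrite !tnth_map in E.
    have [_] := star_root (sAP (tnth t p)).1 E.
    by rewrite sK => -[].
  have [tE Ra] := acyc_const acA tA ta.
  have t0y : t0 = nseq_tuple (ar R) y.
    apply: eq_from_tnth => p; rewrite tnth_nseq; have := t0E p.
    by rewrite !tnth_map ta yT => -[].
  have: R \in lab x.
    by rewrite lE inE -t0y t0R -labE Ra; move: Ra; rewrite inE => /andP[->].
  rewrite inE => /andP[_]; suff -> : map_tuple sA t = nseq_tuple (ar R) x by [].
  by apply: eq_from_tnth => p; rewrite tnth_nseq tnth_map ta sAa.
have /asboolP[s' [s'h s'K s'y]] : `[< liftA y >] by rewrite -[`[< _ >]]negbK -/(mkT y) -mE.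
have /choice[sB sBP] : forall w, exists v,
    projT (val (s (glue_inB a b w))) = Some v /\ h v = glue_inB a' b w.
  move=> w.
  by have [v] := star_inB (sK (glue_inB a b w)); exists v.
have sBb : sB b = y by have := (sBP b).1; rewrite glue_inB_root yT => -[].
exists (glue_fun s' sB); split; last first.
  move=> [v|w] /=; first exact: s'K.
  by rewrite (sBP _).2 glue_inB_val.
apply: glue_fun_hom => //; last by rewrite s'y sBb.
move=> R t tB.
have /star_P := sh _ _ (hom_inB a b tB).
case=> [[t0 t0R t0E]|[t0 [w [t0R wB t0w t0E]]]]; last first.
  suff -> : map_tuple sB t = t0 by [].
  apply: eq_from_tnth => p; have := t0E p.
  by rewrite !tnth_map (sBP _).1 => -[].
have tb p : tnth t p = b.
  have E := t0E p; rewrite !tnth_map in E.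
  have [_] := star_root E (sBP (tnth t p)).1.
  by rewrite sK => /glue_inB_inl[].
have [tE Rb] := acyc_const acB tB tb.
have t0x : t0 = nseq_tuple (ar R) x.
  apply: eq_from_tnth => p; rewrite tnth_nseq; have := t0E p.
  by rewrite !tnth_map tb glue_inB_root xA => -[].
have: R \in labT y.
  by rewrite -lE inE -t0x t0R; move: Rb; rewrite inE => /andP[->].
rewrite inE => /and3P[_ + _]; suff -> : map_tuple sB t = nseq_tuple (ar R) y by [].
by apply: eq_from_tnth => p; rewrite tnth_nseq tnth_map tb sBb.
Qed.

(** The colours that [f] induces on [TA] are transported to [partA]; a root of [T] then takes the
    value of [f] at a pair with a root of [TA] of the same colour. *)
Lemma star_dual j : colset a hA mkA = colset a' hA' (mkT \o val) ->
  hom star (D j) -> hom T (D j).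
Proof.
move=> colE [f fh].
pose S t : {set W} := [set w | `[< exists u : V star, projA (val u) = Some t /\ w = tg (f u) >]].
(* Only colours that occur in [TA] are allowed, so every root of [partA] coloured from [C] has a
   compatible partner. *)
pose C : {set colour} := [set (mkA x, lab x, S x) | x in [set x | hA x == a]].
have: (j, C) \in colset a' hA' (mkT \o val).
  rewrite -colE inE; apply/asboolP; exists S; split=> /=.
  - move=> v va; have vS : inl (inl v) \in starV by rewrite inE.
    exists (f (in_star vS)); rewrite inE; apply/asboolP; by exists (in_star vS).
  - by move=> x xa; apply/imsetP; exists x => //; rewrite inE xa.
  move=> R t tTA d dS.
  have /choice[g gP] : forall p, exists u : V star,
      projA (val u) = Some (tnth t p) /\ tnth d p = f u.
    move=> p.
    have := dS p; rewrite inE => /asboolP[u [uE /tg_inj E]].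
    by exists u.
  suff -> : d = map_tuple f [tuple g p | p < ar R].
    apply/fh/star_P; left; exists t => // p; rewrite tnth_mktuple; exact: (gP p).1.
  apply: eq_from_tnth => p; rewrite tnth_map tnth_mktuple; exact: (gP p).2.
rewrite inE => /asboolP[S' [/= S1 S2 S3]].
(* The value must lie in [S' v] for the tuples over [A'], and be a value of [f] at a vertex above
   [v] for those over [B]. *)
have /choice[g gP] : forall v, exists d : V (D j),
    (forall v' : V partA, val v' = v -> tg d \in S' v') /\
    (forall w, h v = glue_inB a' b w -> exists u : V star, projT (val u) = Some v /\ f u = d).
  move=> v.
  case E: (h v) => [w|q]; last first.
    have vS : inl (inr v) \in starV by rewrite inE E.
    exists (f (in_star vS)); split=> [v' v'E|w _]; last by exists (in_star vS).
    by have := hA'E v'; rewrite v'E E.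
  have vP : v \in [set v | is_inl (h v)] by rewrite inE E.
  pose v1 : V partA := exist _ v vP.
  have v1E v' : val v' = v -> v' = v1 by move=> E'; apply: val_inj.
  have hv1 : hA' v1 = w by have := hA'E v1; rewrite E => -[].
  have [wa|wa] := eqVneq w a'; last first.
    rewrite -hv1 in wa; have [d dS] := S1 _ wa; exists d; split; first by move=> v' /v1E->.
    move=> q /esym/glue_inB_inl[E'' _]; by move: wa; rewrite hv1 E'' eqxx.
  have /imsetP[x] := S2 v1 (etrans hv1 wa).
  rewrite inE => /eqP xa [mE lE SE].
  have uS : inr (x, v) \in starV.
    by rewrite inE xa E wa -mE -lE (lab_partA (etrans hv1 wa)) !eqxx.
  exists (f (in_star uS)); split=> [v' /v1E->|q _]; last by exists (in_star uS).
  by rewrite SE inE; apply/asboolP; exists (in_star uS).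
exists g => R t tT.
case: (glue_P (hh tT)) => [[s sA sE]|[s sB sE]].
  have [t' t'E] : exists t' : (ar R).-tuple (V partA), map_tuple val t' = t.
    apply: sub_lift => p; rewrite inE; have := congr1 (fun t => tnth t p) sE.
    by rewrite !tnth_map => ->.
  apply: (S3 _ t').
        by rewrite inE t'E inE tT; apply/existsP; exists s; rewrite sA sE /=.
  by move=> p; rewrite tnth_map; apply: (gP _).1; rewrite -t'E tnth_map.
have hs p : h (tnth t p) = glue_inB a' b (tnth s p).
  by have := congr1 (fun t => tnth t p) sE; rewrite !tnth_map.
have /choice[u uP] : forall p, exists u : V star,
    projT (val u) = Some (tnth t p) /\ f u = g (tnth t p).
  move=> p.
  exact: (gP _).2 (hs p).
suff -> : map_tuple g t = map_tuple f [tuple u p | p < ar R].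
  apply/fh/star_P; right; exists t, s; split=> // p; rewrite tnth_mktuple; exact: (uP p).1.
by apply: eq_from_tnth => p; rewrite !tnth_map tnth_ord_tuple (uP p).2.
Qed.

End Transfer.

(** Both halves of [in_fam_obstr] are transferred: a map to a dual is changed on [A'] with its value
    at the root kept, and an obstruction over the new gluing is exchanged for [star] over the old
    one, whose section is carried back. *)
Lemma invariant_glue A (a : V A) A' (a' : V A') B (b : V B) : acyc A -> acyc B ->
  invariant a = invariant a' -> in_fam O (glue a b) -> in_fam O (glue a' b).
Proof.
move=> aA aB [labE tauE colE].
move/(in_fam_obstr acO coreO dual) => [oF sF]; apply/(in_fam_obstr acO coreO dual); split.
  move=> j [f fh]; apply: (oF j).
  have: tg (f (inl a')) \in
      [set w : W | `[< exists f : V A' -> V (D (tag w)), is_hom f /\ f a' = tagged w >]].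
    rewrite inE; apply/asboolP; exists (f \o inl); split=> //.
    exact: hom_comp fh (@hom_inl _ _ _ _ _ _).
  rewrite -tauE inE => /asboolP[f' [f'h f'a]].
  exists (glue_fun f' (f \o glue_inB a' b)); apply: glue_fun_hom => //.
    exact: hom_comp fh (@hom_inB _ _ _ _ _ _).
  by rewrite f'a /= glue_inB_root.
move=> T h hh oT.
have: colset a' (hA' (h := h)) (mkT h \o val) \in
  [set c | `[< exists T (h : V T -> V A') mk, marked a' h mk /\ c = colset a' h mk >]].
  by rewrite inE; apply/asboolP; exists (partA h), (hA' (h := h)), (mkT h \o val);
    split=> //; apply: marked_partA.
rewrite -colE inE => /asboolP[TA [hA [mkA [mA cE]]]].
apply: (star_section (a := a) aA aB labE mA).
apply: (sF _ _ (star_hom (h := h) mA)) => j /(star_dual hh (esym cE)).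
exact: oT.
Qed.

(** One rooted forest is chosen for each value of the invariant that a rooted forest attains. *)
Lemma dual_regular : regular O.
Proof.
pose good (i : {set sig} * {set W} * {set {set 'I_m * {set colour}}}) (p : rooted ar) :=
  is_forest (projT1 p) /\ invariant (projT2 p) = i.
have /choice[pick pickP] : forall i, exists o : option (rooted ar),
    if o is Some p then good i p else forall p, ~ good i p.
  move=> i.
  have [[p gp]|np] := pselect (exists p, good i p); first by exists (Some p).
  by exists None => p gp; apply: np; exists p.
exists (pmap pick (enum {: {set sig} * {set W} * {set {set 'I_m * {set colour}}}})).
have inP p : List.In p (pmap pick (enum {: {set sig} * {set W} * {set {set 'I_m * {set colour}}}}))
    <-> exists i, pick i = Some p.
  split.
    elim: (enum _) => [//|i s IH] /=; case E: (pick i) => [q|] //=.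
    by case=> [<-|//]; exists i.
  case=> i iE; have := mem_enum {: {set sig} * {set W} * {set {set 'I_m * {set colour}}}} i.
  elim: (enum _) => [//|i' s IH] /=; rewrite inE; case: eqVneq => [<- _|_ /IH].
    by rewrite iE; left.
  by case: (pick i') => //= q; right.
split=> [p /inP[i iE]|A a fA].
  by have := pickP i; rewrite iE => -[].
have := pickP (invariant a); case E: (pick _) => [p|] gp; last by case: (gp (existT _ A a)).
exists p; split; first by apply/inP; exists (invariant a).
case: p gp {E} => P p [/= fP iE] B b.
split=> -[fB]; move/is_forest_acyc: (fB) => aB; move/is_forest_acyc: fA => aA;
  move/is_forest_acyc: fP => aP; move=> gO; split=> //.
  exact: invariant_glue gO.
exact: invariant_glue gO.
Qed.

End Invariant.

(** * Replacing the parts of a structure by equivalent ones *)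

Section Replace.
Variables (sig : finType) (ar : sig -> nat) (O : sfamily ar).
Implicit Types (A B C F T X Y : struct ar).
Hypothesis forestO : forall A, O A -> is_forest A.

Lemma in_fam_acyc F : in_fam O F -> acyc F.
Proof.
move=> [G [/forestO/is_forest_acyc aG [f [fb fr]]]]; apply: acyc_inj aG; first exact: bij_inj fb.
by move=> R t; rewrite fr.
Qed.

Lemma glue_inB_inj A (a : V A) B (b : V B) : injective (glue_inB a b).
Proof.
move=> v w; have [->|vb] := eqVneq v b.
  by rewrite glue_inB_root => /esym/glue_inB_inl[_ ->].
have [->|wb] := eqVneq w b; first by rewrite glue_inB_root => /glue_inB_inl[].
by rewrite !glue_inB_neq => -[].
Qed.

Lemma acyc_glueR A (a : V A) B (b : V B) : acyc (glue a b) -> acyc B.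
Proof.
apply: (@acyc_inj _ _ B (glue a b) (glue_inB a b)); first exact: glue_inB_inj.
exact: hom_inB.
Qed.

Definition requiv A (a : V A) A' (a' : V A') : Prop :=
  forall B (b : V B), residual O a b <-> residual O a' b.

(** The forest condition in [residual] is automatic: [B] embeds in the gluing, which is isomorphic
    to a forest of [O]. *)
Lemma requiv_in_fam A (a : V A) A' (a' : V A') B (b : V B) : requiv a a' ->
  in_fam O (glue a b) <-> in_fam O (glue a' b).
Proof.
move=> aa'; split=> gO.
  have fB : is_forest B by apply/is_forest_acyc; apply: acyc_glueR (in_fam_acyc gO).
  by have [] := (aa' B b).1 (conj fB gO).
have fB : is_forest B by apply/is_forest_acyc; apply: acyc_glueR (in_fam_acyc gO).
by have [] := (aa' B b).2 (conj fB gO).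
Qed.

Definition liftable A (a : V A) X (u : V X) : Prop :=
  exists C (c : V C), requiv a c /\ exists2 h : V C -> V X, is_hom h & h c = u.

(* [A] consists of a skeleton [(Wc, rc)] and parts [(S k, rp k)] that meet it
   in [x k] only; every part may be replaced by an equivalent rooted structure. *)
Section Skeleton.
Variables (A : struct ar) (K : finType) (S : K -> {set V A}) (x : K -> V A).
Variables (rp : K -> forall R : sig, {set (ar R).-tuple (V A)}).
Variables (Wc : {set V A}) (rc : forall R : sig, {set (ar R).-tuple (V A)}) (a : V A).
Hypotheses (xS : forall k, x k \in S k) (xW : forall k, x k \in Wc) (aW : a \in Wc).
Hypothesis SW : forall k v, v \in S k -> v \in Wc -> v = x k.
Hypothesis SS : forall k k' v, v \in S k -> v \in S k' -> k = k'.
Hypothesis cov : forall v, v \in Wc \/ exists k, v \in S k.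
Hypotheses (wp : forall k, within (S k) (rp k)) (wc : within Wc rc).
Hypothesis relsE : forall R t, t \in rels A R <-> t \in rc R \/ exists k, t \in rp k R.

Definition part k : struct ar := sub_struct (S k) (rp k).
Definition part_root k : V (part k) := exist _ (x k) (xS k).

Variables (C : K -> struct ar) (c : forall k, V (C k)).
Hypothesis Cequiv : forall k, requiv (part_root k) (c k).

Let V1 : finType := (V A + {k : K & V (C k)})%type.
Definition inC k (v : V (C k)) : V1 :=
  if v == c k then inl (x k) else inr (Tagged (fun k => V (C k)) v).

Lemma inC_inj k : injective (@inC k).
Proof.
move=> v w; rewrite /inC; case: eqP => [->|vc]; case: eqP => [->|wc'] //.
by case=> E; apply: (eq_from_Tagged (T_ := fun k => V (C k)) E).
Qed.

Definition replaced : struct ar := @sub_struct _ ar V1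
  [set u | match u with inl v => v \in Wc | inr p => tagged p != c (tag p) end]
  (fun R => [set t | `[< (exists2 s, s \in rc R & t = map_tuple inl s) \/
     exists k, exists2 s, s \in rels (C k) R & t = map_tuple (@inC k) s >]]).

Lemma aW' : inl a \in [set u : V1 |
  match u with inl v => v \in Wc | inr p => tagged p != c (tag p) end].
Proof. by rewrite inE. Qed.

Definition replaced_root : V replaced := exist _ (inl a) aW'.

Lemma replaced_hom X (w : V A -> V X) (h : forall k, V (C k) -> V X) :
  (forall R t, t \in rc R -> map_tuple w t \in rels X R) ->
  (forall k, is_hom (h k)) -> (forall k, h k (c k) = w (x k)) ->
  exists2 f : V replaced -> V X, is_hom f & f replaced_root = w a.
Proof.
move=> wh hh hc.
pose f (u : V1) := match u with inl v => w v | inr p => h (tag p) (tagged p) end.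
have fC k v : f (inC v) = h k v by rewrite /inC; case: eqP => [->|//]; rewrite hc.
exists (f \o val) => // R t; rewrite sub_structE inE -map_tuple_comp => /asboolP[[s sR ->]|].
  by rewrite map_tuple_comp; apply: wh.
move=> [k [s sR ->]]; rewrite map_tuple_comp (@eq_map_tuple _ _ _ _ (h k)); first exact: hh.
by move=> p; apply: fC.
Qed.

Section Context.
Variables (B : struct ar) (b : V B).
Let V0 : finType := (V1 + V B)%type.
Let iA (v : V A) : V0 := inl (inl v).
Let iC k (v : V (C k)) : V0 := inl (inC v).
Let iB (w : V B) : V0 := if w == b then iA a else inr w.

Lemma iB_inj : injective iB.
Proof.
move=> v w; rewrite /iB; case: eqP => [->|vc]; case: eqP => [->|wc'] //.
by move=> [].
Qed.

(* The skeleton and [B], the original parts in [J0] and the new parts in [J1]. *)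
Definition mixV (J0 J1 : {set K}) : {set V0} := [set u | match u with
  | inl (inl v) => (v \in Wc) || [exists k in J0, v \in S k]
  | inl (inr p) => (tag p \in J1) && (tagged p != c (tag p))
  | inr w => w != b end].
Definition mixr (J0 J1 : {set K}) R : {set (ar R).-tuple V0} := [set t | `[<
  [\/ exists2 s, s \in rc R & t = map_tuple iA s,
      exists2 s, s \in rels B R & t = map_tuple iB s,
      exists2 k, k \in J0 & exists2 s, s \in rp k R & t = map_tuple iA s
    | exists2 k, k \in J1 & exists2 s, s \in rels (C k) R & t = map_tuple (@iC k) s] >]].
Definition mix J0 J1 : struct ar := sub_struct (mixV J0 J1) (mixr J0 J1).

Lemma mixV_A (J0 J1 : {set K}) v : v \in Wc -> iA v \in mixV J0 J1.
Proof. by move=> vW; rewrite inE /= vW. Qed.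
Lemma mixV_C (J0 J1 : {set K}) k v : k \in J1 -> @iC k v \in mixV J0 J1.
Proof.
move=> kJ; rewrite /iC /inC; case: eqP => [_|/eqP vc]; first exact: mixV_A.
by rewrite inE /= kJ.
Qed.
Lemma mixV_B (J0 J1 : {set K}) w : iB w \in mixV J0 J1.
Proof. by rewrite /iB; case: eqP => [_|/eqP wb]; [exact: mixV_A|rewrite inE]. Qed.

Lemma mix_within (J0 J1 : {set K}) : within (mixV J0 J1) (mixr J0 J1).
Proof.
move=> R t; rewrite inE => /asboolP[[s sR ->]|[s sR ->]|[k kJ [s sR ->]]|[k kJ [s sR ->]]] i;
  rewrite tnth_map.
- exact/mixV_A/(wc sR).
- exact: mixV_B.
- rewrite inE; apply/orP; right; apply/existsP; exists k; rewrite kJ; exact: (wp sR).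
- exact: mixV_C.
Qed.

Definition mix_root J0 J1 k : V (mix J0 J1) := exist _ (iA (x k)) (mixV_A J0 J1 (xW k)).

Lemma val_mixr (J0 J1 : {set K}) R t : t \in mixr J0 J1 R <->
  exists2 s, s \in rels (mix J0 J1) R & t = map_tuple val s.
Proof.
split=> [/(val_sub_rels (@mix_within J0 J1))[s sR <-]|[s sR ->]]; first by exists s.
by move: sR; rewrite sub_structE.
Qed.

(** With [mix_new], this shows two mixtures that differ only in part [k] as gluings with the same
    remainder, at [x k]. *)
Lemma mix_old (J0 J1 : {set K}) k : k \notin J0 ->
  iso (glue (part_root k) (mix_root J0 J1 k)) (mix (k |: J0) J1).
Proof.
move=> kJ.
apply: (@glue_sub_struct _ _ (part k) (part_root k) (mix J0 J1) (mix_root J0 J1 k)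
  _ _ _ (iA \o val) val) => //.
- by move=> u v [] /val_inj.
- exact: val_inj.
- move=> [v vS] [u uM] /= E.
  have uM' : iA v \in mixV J0 J1 by rewrite E.
  rewrite inE /= in uM'.
  have vx : v = x k.
    case/orP: uM' => [|/existsP[k' /andP[kJ' vS']]]; first exact: SW.
    by move: kJ; rewrite (SS vS vS') kJ'.
  by split; apply: val_inj => //=; rewrite -E vx.
- move=> u; split.
    case: (boolP (u \in mixV J0 J1)) => [uM _|uM]; first by right; exists (exist _ u uM).
    case: u uM => [[v|p]|w]; rewrite !inE //= => uM; try by rewrite (negbTE uM).
    move=> uM'; left; suff vS : v \in S k by exists (exist _ v vS).
    move: uM uM'; rewrite negb_or => /andP[/negbTE-> /= /existsP nE].
    case/existsP => k' /andP[]; rewrite !inE => /orP[/eqP->//|kJ' vS].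
    by case: nE; exists k'; rewrite kJ'.
  case=> [[[v vS] ->]|[[u' uM] ->]] /=.
    by rewrite inE; apply/orP; right; apply/existsP; exists k; rewrite setU11.
  move: uM; case: u' => [[v|p]|w]; rewrite !inE //= => /orP[->//|/existsP[k' /andP[kJ' vS]]].
  by apply/orP; right; apply/existsP; exists k'; rewrite !inE kJ' orbT.
move=> R t; rewrite -val_mixr inE; split=> [/asboolP|].
  case=> [H|H|[k' kJ' [s sR ->]]|H].
  - by right; rewrite inE; apply/asboolP; constructor 1.
  - by right; rewrite inE; apply/asboolP; constructor 2.
  - case/setU1P: kJ' => [E|kJ'].
      subst k'; left; have [s' s'R <-] := val_sub_rels (@wp k) sR.
      by exists s'; rewrite ?map_tuple_comp.
    by right; rewrite inE; apply/asboolP; constructor 3; exists k' => //; exists s.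
  - by right; rewrite inE; apply/asboolP; constructor 4.
case=> [[s sR ->]|H]; apply/asboolP.
  constructor 3; exists k; first by rewrite setU11.
  by exists (map_tuple val s); [move: sR; rewrite sub_structE|rewrite map_tuple_comp].
move: H; rewrite inE => /asboolP[H|H|[k' kJ' H]|H];
  [constructor 1|constructor 2|constructor 3|constructor 4] => //.
by exists k' => //; rewrite !inE kJ' orbT.
Qed.

Lemma mix_new (J0 J1 : {set K}) k : k \notin J1 ->
  iso (glue (c k) (mix_root J0 J1 k)) (mix J0 (k |: J1)).
Proof.
move=> kJ.
apply: (@glue_sub_struct _ _ (C k) (c k) (mix J0 J1) (mix_root J0 J1 k) _ _ _ (@iC k) val) => //.
- by move=> u v [] /inC_inj.
- exact: val_inj.
- by rewrite /iC /inC eqxx.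
- move=> v [u uM] /= E.
  have: @iC k v \in mixV J0 J1 by rewrite E.
  rewrite /iC /inC; case: eqP => [vc _|_].
    by split=> //; apply: val_inj; rewrite /= -E vc /iC /inC eqxx.
  by rewrite inE /= (negbTE kJ).
- move=> u; split.
    case: (boolP (u \in mixV J0 J1)) => [uM _|uM]; first by right; exists (exist _ u uM).
    case: u uM => [[v|[k' v]]|w]; rewrite !inE //= => uM; try by rewrite (negbTE uM).
    case/andP => /orP[/eqP E|kJ'] vc; last by rewrite kJ' vc in uM.
    by subst k'; left; exists v; rewrite /iC /inC (negbTE vc).
  case=> [[v ->]|[[u' uM] ->]] /=; first by apply: mixV_C; rewrite setU11.
  by move: uM; case: u' => [[v|p]|w]; rewrite !inE //= => /andP[-> ->]; rewrite orbT.
move=> R t; rewrite -val_mixr inE; split=> [/asboolP|].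
  case=> [H|H|H|[k' kJ' [s sR ->]]].
  - by right; rewrite inE; apply/asboolP; constructor 1.
  - by right; rewrite inE; apply/asboolP; constructor 2.
  - by right; rewrite inE; apply/asboolP; constructor 3.
  case/setU1P: kJ' => [E|kJ']; first by subst k'; left; exists s.
  by right; rewrite inE; apply/asboolP; constructor 4; exists k' => //; exists s.
case=> [[s sR ->]|H]; apply/asboolP.
  by constructor 4; exists k; rewrite ?setU11 //; exists s.
move: H; rewrite inE => /asboolP[H|H|H|[k' kJ' H]];
  [constructor 1|constructor 2|constructor 3|constructor 4] => //.
by exists k' => //; rewrite !inE kJ' orbT.
Qed.

Lemma mix_start : iso (glue a b) (mix setT set0).
Proof.
apply: (@glue_sub_struct _ _ A a B b _ _ _ iA iB).
- by move=> u v [].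
- exact: iB_inj.
- by rewrite /iB eqxx.
- by move=> v w; rewrite /iB; case: eqP => [-> [->]|].
- move=> u; split.
    case: u => [[v|p]|w]; rewrite inE /=; [by left; exists v|by rewrite inE|].
    by move=> wb; right; exists w; rewrite /iB (negbTE wb).
  case=> [[v ->]|[w ->]]; last exact: mixV_B.
  rewrite inE /=; have [->//|[k vS]] := cov v.
  by apply/orP; right; apply/existsP; exists k; rewrite inE.
move=> R t; rewrite inE; split=> [/asboolP|].
  case=> [[s sR ->]|H|[k _ [s sR ->]]|[k]]; last by rewrite inE.
  - by left; exists s => //; apply/relsE; left.
  - by right.
  - by left; exists s => //; apply/relsE; right; exists k.
case=> [[s /relsE[sR|[k sR]] ->]|H]; apply/asboolP.
- by constructor 1; exists s.
- by constructor 3; exists k; rewrite ?inE //; exists s.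
- by constructor 2.
Qed.

Lemma mix_end : iso (glue replaced_root b) (mix set0 setT).
Proof.
apply: (@glue_sub_struct _ _ replaced replaced_root B b _ _ _ (inl \o val) iB).
- by move=> u v [] /val_inj.
- exact: iB_inj.
- by rewrite /iB eqxx.
- move=> [v vW] w; rewrite /iB; case: eqP => [-> [E]|//].
  by split=> //; apply: val_inj.
- move=> u; split.
    case: u => [v|w]; last by rewrite inE => wb; right; exists w; rewrite /iB (negbTE wb).
    move=> vM; left.
    suff vW : v \in [set u : V1 |
        match u with inl v => v \in Wc | inr p => tagged p != c (tag p) end].
      by exists (exist _ v vW).
    move: vM; case: v => [v|p]; rewrite !inE //= => /orP[//|/existsP[k]].
    by rewrite inE.
  case=> [[v ->]|[w ->]]; last exact: mixV_B.
  by have := valP v; rewrite /=; case: (sval v) => [v'|p]; rewrite !inE //= => ->.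
move=> R t; rewrite inE; split=> [/asboolP|].
  have lW s : (forall i, tnth s i \in [set u : V1 |
      match u with inl v => v \in Wc | inr p => tagged p != c (tag p) end]) ->
      ((exists2 s', s' \in rc R & s = map_tuple inl s') \/
       exists k, exists2 s', s' \in rels (C k) R & s = map_tuple (@inC k) s') ->
      exists2 s', s' \in rels replaced R &
        map_tuple inl s = map_tuple (inl \o val) s' :> (ar R).-tuple V0.
    move=> sW H; have [s' s'E] := sub_lift sW; exists s'; last by rewrite -map_tuple_comp s'E.
    by rewrite sub_structE s'E inE; apply/asboolP.
  case=> [[s sR ->]|H|[k]|[k _ [s sR ->]]]; [left|by right|by rewrite inE|left].
    have := lW (map_tuple inl s); rewrite map_tuple_comp; apply.
      by move=> i; rewrite tnth_map inE /=; apply: (wc sR).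
    by left; exists s.
  have := lW (map_tuple (@inC k) s); rewrite map_tuple_comp; apply.
    by move=> i; rewrite tnth_map /inC; case: eqP => [_|/eqP nc]; rewrite inE.
  by right; exists k, s.
case=> [[s sR ->]|H]; apply/asboolP; last by constructor 2.
move: sR; rewrite sub_structE inE => /asboolP[[s' s'R E]|[k [s' s'R E]]]; rewrite -map_tuple_comp E.
  by constructor 1; exists s' => //; rewrite map_tuple_comp.
by constructor 4; exists k; rewrite ?inE //; exists s' => //; rewrite map_tuple_comp.
Qed.

Lemma mix_step (J0 J1 : {set K}) k : k \notin J0 -> k \notin J1 ->
  in_fam O (mix (k |: J0) J1) <-> in_fam O (mix J0 (k |: J1)).
Proof.
move=> kJ0 kJ1.
rewrite -(in_fam_iso O (mix_old J1 kJ0)) -(in_fam_iso O (mix_new J0 kJ1)).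
exact/requiv_in_fam/Cequiv.
Qed.

(** The parts are exchanged one at a time along an enumeration of [K]. *)
Lemma mix_all : in_fam O (mix setT set0) <-> in_fam O (mix set0 setT).
Proof.
have step (s : seq K) : uniq s ->
    in_fam O (mix setT set0) <-> in_fam O (mix (~: [set k in s]) [set k in s]).
  elim: s => [_|k s IH /= /andP[ks us]].
    have -> : [set k in [::]] = set0 :> {set K} by apply/setP => k; rewrite !inE.
    by rewrite setC0.
  have -> : [set k' in k :: s] = k |: [set k' in s] by apply/setP => k'; rewrite !inE.
  rewrite IH //.
  have {1}-> : ~: [set k' in s] = k |: ~: (k |: [set k' in s]).
    by apply/setP => k'; rewrite !inE negb_or; case: eqVneq => [->|] //=.
  by apply: mix_step; rewrite !inE ?eqxx.
rewrite (step _ (enum_uniq K)).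
have -> : [set k in enum K] = setT by apply/setP => k; rewrite !inE mem_enum.
by rewrite setCT.
Qed.

End Context.

Lemma replaced_requiv : requiv a replaced_root.
Proof.
move=> B b; have E := mix_all b.
rewrite -(in_fam_iso O (mix_start b)) -(in_fam_iso O (mix_end b)) in E.
by split=> -[fB gO]; split=> //; apply/E.
Qed.

End Skeleton.

(** The homomorphisms from the equivalent parts agree with [w] at the points [x k], so with [w] on
    the skeleton they define one on [replaced]. *)
Lemma skeleton_lift A (K : finType) (S : K -> {set V A}) (x : K -> V A)
    (rp : K -> forall R : sig, {set (ar R).-tuple (V A)})
    (Wc : {set V A}) (rc : forall R : sig, {set (ar R).-tuple (V A)}) (a : V A)
    (xS : forall k, x k \in S k) X (w : V A -> V X) :
  (forall k, x k \in Wc) -> a \in Wc ->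
  (forall k v, v \in S k -> v \in Wc -> v = x k) ->
  (forall k k' v, v \in S k -> v \in S k' -> k = k') ->
  (forall v, v \in Wc \/ exists k, v \in S k) ->
  (forall k, within (S k) (rp k)) -> within Wc rc ->
  (forall R t, t \in rels A R <-> t \in rc R \/ exists k, t \in rp k R) ->
  (forall R t, t \in rc R -> map_tuple w t \in rels X R) ->
  (forall k, liftable (part_root rp xS k) (w (x k))) -> liftable a (w a).
Proof.
move=> xW aW SW SS cov wp wc relsE wh H.
have /choice[p pP] : forall k, exists p : {C : struct ar & {c : V C & V C -> V X}},
    [/\ requiv (part_root rp xS k) (projT1 (projT2 p)), is_hom (projT2 (projT2 p))
      & projT2 (projT2 p) (projT1 (projT2 p)) = w (x k)].
  by move=> k; have [C [c [rc' [h hh hc]]]] := H k; exists (existT _ C (existT _ c h)).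
pose C k := projT1 (p k); pose c k : V (C k) := projT1 (projT2 (p k)).
pose h k : V (C k) -> V X := projT2 (projT2 (p k)).
exists (replaced x Wc rc c), (replaced_root x rc aW c); split.
  by apply: (@replaced_requiv _ _ S x rp) => // k; have [] := pP k.
by apply: (@replaced_hom _ _ _ _ _ _ _ _ _ _ w h) => // k; have [] := pP k.
Qed.

End Replace.

(** * Regular families of forests have finite duals *)

Section RegularDual.
Variables (sig : finType) (ar : sig -> nat) (O : sfamily ar).
Implicit Types (A B C F T X Y : struct ar).
Hypothesis forestO : forall A, O A -> is_forest A.
Variables (n : nat) (L : 'I_n -> rooted ar).
Hypothesis Lcov : forall A (a : V A), is_forest A -> exists i, requiv O a (projT2 (L i)).

Lemma lift_requiv A (a : V A) A' (a' : V A') X (u : V X) : requiv O a a' ->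
  liftable O a u <-> liftable O a' u.
Proof.
move=> E; split=> -[C [c [ac H]]]; exists C, c; split=> // B b.
  by rewrite -(E B b); apply: ac.
by rewrite (E B b); apply: ac.
Qed.

Lemma lift_hom A (a : V A) X (u : V X) Y (f : V X -> V Y) :
  is_hom f -> liftable O a u -> liftable O a (f u).
Proof.
move=> fh [C [c [ac [h hh hc]]]]; exists C, c; split=> //.
by exists (f \o h); [exact: hom_comp|rewrite /= hc].
Qed.

Definition classes X (u : V X) : {set 'I_n} := [set i | `[< liftable O (projT2 (L i)) u >]].

(** Every rooted forest is equivalent to some [L i], so [classes] decides which forests lift at a
    vertex. *)
Lemma lift_classes A (a : V A) X (u : V X) Y (v : V Y) : acyc A ->
  classes u = classes v -> liftable O a u -> liftable O a v.
Proof.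
move=> /is_forest_acyc/(Lcov a)[i E] uv /(lift_requiv _ E) l.
by apply/(lift_requiv _ E); have := in_set (fun i => `[< liftable O (projT2 (L i)) u >]) i;
  rewrite -/(classes u) uv inE (asboolT l) => /asboolP.
Qed.

Definition add_point X : struct ar :=
  @Struct sig ar (option (V X)) (fun R => [set map_tuple Some t | t in rels X R]).

Definition good X := ~ exists T, O T /\ hom T X.

Definition nullary X : {set sig} := [set R : sig | (ar R == 0) && (rels X R != set0)].

(* Rooted forests mapping to [add_point X] at [None] have an isolated root, so
   the second component records the unrooted forests mapping to [X]. *)
Definition type_of X : {set sig} * {set 'I_n} :=
  (nullary X, classes (None : V (add_point X))).

(** Different tuples may be realised in different [X]; fixing the type makes these agree on nullary
    relations and on the liftings at an added isolated point. *)
Definition dual_of (tau : {set sig} * {set 'I_n}) : struct ar :=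
  @Struct sig ar
    {q : {set 'I_n} | `[< exists X (x : V X), [/\ good X, type_of X = tau & classes x = q] >]}
    (fun R => [set t | `[< exists X (s : (ar R).-tuple (V X)),
       [/\ good X, type_of X = tau, s \in rels X R
         & forall p, val (tnth t p) = classes (tnth s p)] >]]).

Lemma hom_dual_of X : good X -> hom X (dual_of (type_of X)).
Proof.
move=> gX.
have xP (x : V X) : `[< exists Y (y : V Y),
    [/\ good Y, type_of Y = type_of X & classes y = classes x] >].
  by apply/asboolP; exists X, x.
exists (fun x => exist _ (classes x) (xP x)) => R t tX.
by rewrite inE; apply/asboolP; exists X, t; split=> // p; rewrite tnth_map.
Qed.

(** Tuples count as well as vertices, since the induction removes either a block or an isolated
    root. *)
Definition weight A := #|V A| + \sum_R #|rels A R|.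

Lemma card_sub_rels (U : finType) (W : {set U}) (r : forall R : sig, {set (ar R).-tuple U}) R :
  #|rels (sub_struct W r) R| <= #|r R|.
Proof.
rewrite -(card_imset _ (map_tuple_inj (n := ar R) (@val_inj _ _ {v : U | v \in W}))).
apply/subset_leq_card/subsetP => _ /imsetP[t tr ->].
by move: tr; rewrite sub_structE.
Qed.

Lemma weight_sub A (W : {set V A}) (r : forall R : sig, {set (ar R).-tuple (V A)}) :
  (forall R, r R \subset rels A R) ->
  (W \proper setT) || [exists R, r R \proper rels A R] ->
  weight (sub_struct W r) < weight A.
Proof.
move=> rA H.
have le1 : #|V (sub_struct W r)| <= #|V A| by rewrite card_sig; apply: max_card.
have le2 R : #|rels (sub_struct W r) R| <= #|rels A R|.
  exact: leq_trans (card_sub_rels W r R) (subset_leq_card (rA R)).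
case/orP: H => [WT|/existsP[R rR]].
  rewrite /weight -addSn leq_add //; last by apply: leq_sum => R _.
  by rewrite card_sig -cardsT; apply: leq_trans (proper_card WT); rewrite ltnS subset_leq_card.
rewrite /weight -addnS leq_add // (bigD1 R) //= [X in _ <= X](bigD1 R) //= -addSn leq_add //.
  exact: leq_ltn_trans (card_sub_rels W r R) (proper_card rR).
by apply: leq_sum.
Qed.

(** The pairwise colourings combine: a vertex goes to position [i] if it sides with [tnth t i]
    against every other position. *)
Lemma acyc_parts A R (t : (ar R).-tuple (V A)) (i0 : 'I_(ar R)) : acyc A -> t \in rels A R ->
  exists f : V A -> 'I_(ar R), (forall i, f (tnth t i) = i) /\
    forall R' (t' : (ar R').-tuple (V A)), t' \in rels A R' ->
       (Tagged (fun R => (ar R).-tuple (V A)) t' : {R & _}) <> Tagged _ t ->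
       forall v w, v \in t' -> w \in t' -> f v = f w.
Proof.
move=> aA tA.
have /choice[k kP] : forall p : 'I_(ar R) * 'I_(ar R), exists k : V A -> bool, p.1 != p.2 ->
    (forall R' (t' : (ar R').-tuple (V A)), t' \in rels A R' ->
       (Tagged (fun R => (ar R).-tuple (V A)) t' : {R & _}) <> Tagged _ t ->
       forall v w, v \in t' -> w \in t' -> k v = k w)
    /\ k (tnth t p.1) <> k (tnth t p.2).
  move=> [i j] /=; have [//|ij] := eqVneq i j; first by exists (fun=> true).
  by have [k kP] := aA _ _ tA _ _ ij; exists k.
pose P v i := [forall j, (i != j) ==> (k (i, j) v == k (i, j) (tnth t i))].
have Pt i j : P (tnth t i) j = (i == j).
  apply/forallP/eqP => [H|-> j']; last by rewrite eqxx implybT.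
  apply/esym/eqP; apply/negP => /negP ji; have := H i; rewrite ji => /eqP E.
  by have [_] := kP (j, i) ji; rewrite /= E.
(* Vertices that side with no position go to [i0]. *)
exists (fun v => odflt i0 [pick i | P v i]); split.
  by move=> i; case: pickP => [j|/(_ i)] /=; rewrite Pt ?eqxx // => /eqP.
move=> R' t' t'A nE v w vt wt; congr odflt; apply: eq_pick => i.
apply: eq_forallb => j; case: (boolP (i == j)) => //= ij.
by have [H _] := kP (i, j) ij; rewrite (H _ _ t'A nE _ _ vt wt).
Qed.

(** * Lifting forests from a dual to good structures *)

Section Lifting.
Variable tau : {set sig} * {set 'I_n}.

Lemma nullary_hom A X (g : V A -> V (dual_of tau)) (f : V A -> V X) R (t : (ar R).-tuple (V A)) :
  type_of X = tau -> ar R = 0 -> is_hom g -> t \in rels A R -> map_tuple f t \in rels X R.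
Proof.
move=> tX R0 gh tA.
have := gh _ _ tA; rewrite inE => /asboolP[X2 [s [_ tX2 sX2 _]]].
have: R \in nullary X.
  have <- : nullary X2 = nullary X by have := congr1 fst (etrans tX2 (esym tX)).
  by rewrite inE; apply/andP; split; [apply/eqP|apply/set0Pn; exists s].
rewrite inE => /andP[_ /set0Pn[s' s'X]]; suff -> : map_tuple f t = s' by [].
by apply: val_inj; rewrite /= !(size0nil (etrans (size_tuple _) R0)).
Qed.

Definition lifting A := forall (a : V A) (g : V A -> V (dual_of tau)), is_hom g ->
  forall X (u : V X), good X -> type_of X = tau -> val (g a) = classes u -> liftable O a u.

(** The image of the block is realised by a tuple [s] of one good [X2]. Deleting the block leaves
    smaller parts, which lift at the entries of [s] by induction; the block itself is the
    skeleton. *)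
Lemma lifting_block A (a : V A) (g : V A -> V (dual_of tau)) R (t : (ar R).-tuple (V A))
    X (u : V X) :
  acyc A -> is_hom g -> t \in rels A R -> a \in t -> val (g a) = classes u ->
  (forall A', weight A' < weight A -> acyc A' -> lifting A') -> liftable O a u.
Proof.
move=> aA gh tA /tnthP[j aE] gu IH.
have [f [ft fc]] := acyc_parts j aA tA.
have := gh _ _ tA; rewrite inE => /asboolP[X2 [s [gX2 tX2 sX2 sE]]].
have {}sE p : val (g (tnth t p)) = classes (tnth s p) by rewrite -sE tnth_map.
apply: (@lift_classes _ _ X2 (tnth s j)) => //; first by rewrite -gu aE sE.
pose isT R' (t' : (ar R').-tuple (V A)) :=
  (Tagged (fun R => (ar R).-tuple (V A)) t' : {R : sig & _}) == Tagged _ t.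
pose S l := [set v | f v == l].
pose rp l R' : {set (ar R').-tuple (V A)} :=
  [set t' in rels A R' | ~~ isT _ t' & [forall p, tnth t' p \in S l]].
pose rc R' : {set (ar R').-tuple (V A)} := [set t' | isT _ t'].
have isTP R' t' : isT R' t' -> t' \in rels A R' /\ forall p, tnth t' p \in t.
  move/eqP => E; move: (congr1 tag E) => /= RE; case: _ / (esym RE) t' E => t' E.
  by rewrite (eq_from_Tagged E); split=> // p; apply: mem_tnth.
have xS l : tnth t l \in S l by rewrite inE ft.
have <- : tnth s (f a) = tnth s j by rewrite aE ft.
apply: (@skeleton_lift _ _ _ forestO A _ S (tnth t) rp [set v | v \in t] rc a xS X2
  (fun v => tnth s (f v))).
- by move=> l; rewrite inE mem_tnth.
- by rewrite inE aE mem_tnth.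
- by move=> l v; rewrite !inE => /eqP <- /tnthP[i ->]; rewrite ft.
- by move=> l l' v; rewrite !inE => /eqP <- /eqP.
- by move=> v; right; exists (f v); rewrite inE.
- by move=> l R' t'; rewrite inE => /and3P[_ _ /forallP].
- by move=> R' t'; rewrite inE => /isTP[_ H] p; rewrite inE.
- move=> R' t'; split=> [t'A|[|[l]]]; last by rewrite inE => /andP[].
    have [tt|ntt] := boolP (isT R' t'); [by left; rewrite inE|right].
    have [v vt|t0] := pickP (mem t').
      exists (f v); rewrite inE t'A ntt; apply/forallP => p; rewrite inE; apply/eqP.
      by apply: (fc _ _ t'A) => //; [apply/eqP|apply: mem_tnth].
    (* A nullary block fits in every part. *)
    exists j; rewrite inE t'A ntt; apply/forallP => p.
    by have := t0 (tnth t' p); rewrite /= mem_tnth.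
  by rewrite inE => /isTP[].
- move=> R' t'; rewrite inE => /eqP E.
  move: (congr1 tag E) => /= RE; case: _ / (esym RE) t' E => t' E.
  rewrite (eq_from_Tagged E); suff -> : map_tuple (fun v => tnth s (f v)) t = s by [].
  by apply: eq_from_tnth => p; rewrite tnth_map ft.
move=> l; rewrite ft.
have rpA R' : rp l R' \subset rels A R' by apply/subsetP => t'; rewrite inE => /and3P[].
apply: (IH (part S rp l) _ _ (part_root rp xS l) (g \o val)) => //.
- apply: weight_sub => //; apply/orP; right; apply/existsP; exists R.
  rewrite properE rpA; apply/subsetPn; exists t => //.
  by rewrite inE tA /isT eqxx.
- by apply: acyc_sub => // R' t'; apply/subsetP.
- move=> R' t'; rewrite sub_structE -map_tuple_comp => t'r; apply: gh.
  exact: (subsetP (rpA R')).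
exact: sE.
Qed.

(** The rest of [A], rooted at [y], lifts to some [X2] realising [g y], so [A] lifts at the added
    point of [X2]. By equality of types it lifts at the added point of [X], which is then sent to
    [u]. *)
Lemma lifting_isolated A (a y : V A) (g : V A -> V (dual_of tau)) X (u : V X) :
  acyc A -> is_hom g -> (forall R (t : (ar R).-tuple (V A)), t \in rels A R -> a \notin t) ->
  y != a -> type_of X = tau ->
  (forall A', weight A' < weight A -> acyc A' -> lifting A') -> liftable O a u.
Proof.
move=> aA gh ia ya tX IH.
have /asboolP[X2 [v [gX2 tX2 vE]]] := valP (g y).
pose f (o : V (add_point X)) : V X := if o is Some x then x else u.
have fh : is_hom f.
  move=> R _ /imsetP[t tX' ->]; rewrite map_tuple_comp map_tuple_id //.
suff: liftable O a (None : V (add_point X)) by move/(lift_hom fh).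
have: type_of X2 = type_of X by rewrite tX tX2.
move/(congr1 snd)/(lift_classes aA); apply.
pose w z : V (add_point X2) := if z == a then None else Some v.
have <- : w a = None by rewrite /w eqxx.
have xS (k : unit) : y \in [set~ a] by rewrite !inE.
apply: (@skeleton_lift _ _ _ forestO A _ (fun=> [set~ a]) (fun=> y) (fun=> rels A) [set a; y]
  (fun=> set0) a xS) => //.
- by move=> k; rewrite !inE eqxx orbT.
- by rewrite !inE eqxx.
- by move=> k z; rewrite !inE => /negbTE-> /eqP.
- by move=> [] [].
- by move=> z; rewrite !inE; case: (z =P a) => [|za]; [left|right; exists tt; apply/eqP].
- move=> k R t tA p; rewrite !inE; apply: contraNneq (ia _ _ tA) => <-; exact: mem_tnth.
- by move=> R t; rewrite inE.
- by move=> R t; split=> [tA|[|[]//]]; [right; exists tt|rewrite inE].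
- by move=> R t; rewrite inE.
move=> k; rewrite /w (negbTE ya).
have sh : is_hom (Some : V X2 -> V (add_point X2)) by move=> R t tX2'; apply: imset_f.
apply: (lift_hom sh).
apply: (IH (part (fun=> [set~ a]) (fun=> rels A) k) _ _
  (part_root (fun=> rels A) xS k) (g \o val)) => //.
- apply: weight_sub => //; apply/orP; left; rewrite properE subsetT; apply/subsetPn.
  by exists a; rewrite !inE ?eqxx.
- exact: acyc_sub.
- by move=> R t; rewrite sub_structE -map_tuple_comp; apply: gh.
Qed.

Lemma lifting_point A (a : V A) (g : V A -> V (dual_of tau)) X (u : V X) :
  is_hom g -> (forall R (t : (ar R).-tuple (V A)), t \in rels A R -> a \notin t) ->
  (forall y, y = a) -> type_of X = tau -> liftable O a u.
Proof.
move=> gh ia ya tX; exists A, a; split=> //; exists (fun=> u) => // R t tA.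
have R0 : ar R = 0.
  case E: (ar R) => [//|m]; have i : 'I_(ar R) by rewrite E; exact: ord0.
  by have := ia _ _ tA; rewrite -(ya (tnth t i)) mem_tnth.
exact: nullary_hom tX R0 gh tA.
Qed.

Lemma liftingP A : acyc A -> lifting A.
Proof.
have [k] := ubnP (weight A); elim: k A => // k IH A wA aA a g gh X u gX tX gu.
have {}IH A' : weight A' < weight A -> acyc A' -> lifting A'.
  by move=> w'; apply: IH; apply: leq_trans w' _; rewrite -ltnS.
have [[R [t [tA at']]]|ia] := pselect
    (exists R (t : (ar R).-tuple (V A)), t \in rels A R /\ a \in t).
  exact: lifting_block aA gh tA at' gu IH.
have {}ia R (t : (ar R).-tuple (V A)) : t \in rels A R -> a \notin t.
  by move=> tA; apply/negP => at'; apply: ia; exists R, t.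
have [y ya|ya] := pickP (fun y => y != a); first exact: lifting_isolated aA gh ia ya tX IH.
apply: (lifting_point u gh ia _ tX) => y; apply/eqP; exact: negbFE (ya y).
Qed.

(** A lift of [T] is an equivalent [C] mapping to a good [X]. Since [T] is its own gluing with a
    single point, the same gluing of [C] is in the family, yet it maps to [X]. *)
Lemma obstruction_dual_of X0 T : good X0 -> type_of X0 = tau -> O T -> ~ hom T (dual_of tau).
Proof.
move=> gX0 tX0 OT [g gh]; have aT := (is_forest_acyc T).1 (forestO OT).
have [a _|noT] := pickP (fun _ : V T => true); last first.
  (* Without vertices [T] has only nullary tuples, which the type of [X0] provides. *)
  apply: gX0; exists T; split=> //.
  exists (fun v => False_rect _ (Bool.diff_true_false (noT v))) => R t tT.
  have R0 : ar R = 0.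
    case E: (ar R) => [//|m]; have i : 'I_(ar R) by rewrite E; exact: ord0.
    by have := noT (tnth t i).
  exact: nullary_hom tX0 R0 gh tT.
have /asboolP[X [x [gX tX xE]]] := valP (g a).
have [C [c [ac [h hh hc]]]] := liftingP aT gh gX tX (esym xE).
pose pt : struct ar := @Struct sig ar unit (fun=> set0).
have Tpt : iso T (glue a (tt : V pt)).
  exists inl; split.
    exists (fun z : V (glue a (tt : V pt)) => match z with inl v => v | inr _ => a end) => //.
    by case=> [//|[[] //]].
  move=> R t; apply/idP/idP => [|/glue_P[[s sT]|[s]]]; first exact: hom_inl.
    by move/(map_tuple_inj _) => -> // v w [].
  by rewrite inE.
have : in_fam O (glue a (tt : V pt)).
  by apply/(in_fam_iso O Tpt); exists T; split=> //; apply: iso_refl.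
move/(requiv_in_fam forestO _ ac) => [G [OG GE]].
apply: gX; exists G; split=> //; apply: hom_trans (iso_hom (iso_sym GE)) _.
exists (glue_fun h (fun=> x)); apply: glue_fun_hom => // R t.
by rewrite inE.
Qed.

End Lifting.

Lemma regular_dual : exists D : seq (struct ar), duality_pair O D.
Proof.
(* Unrealised types are dropped: if [O] contains the empty structure without tuples, nothing is good
   and the list must be empty. *)
pose real tau := `[< exists X, good X /\ type_of X = tau >].
have inP (U : eqType) (s : seq U) x : List.In x s <-> x \in s.
  elim: s => [|y s IH] /=; first by rewrite in_nil.
  rewrite inE; split=> [[->|/IH->]|/predU1P[->|/IH]]; rewrite ?eqxx ?orbT //; by [left|right].
exists (map dual_of (filter real (enum {: {set sig} * {set 'I_n}}))) => A; split.
  case=> _ /List.in_map_iff[tau [<- /inP]]; rewrite mem_filter => /andP[/asboolP[X [gX tX]] _] AD.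
  move=> [T [OT TA]]; exact: (obstruction_dual_of gX tX OT (hom_trans TA AD)).
move=> gA; exists (dual_of (type_of A)); last exact: hom_dual_of.
apply/List.in_map_iff; exists (type_of A); split=> //; apply/inP.
by rewrite mem_filter mem_enum andbT; apply/asboolP; exists A.
Qed.

End RegularDual.

Theorem theorem5p3 (sig : finType) (ar : sig -> nat) (O : sfamily ar) :
  antichain O -> (forall A, O A -> is_core A) ->
  ((exists D : seq (struct ar), duality_pair O D) <->
   ((forall A, O A -> is_forest A) /\ regular O)).
Proof.
move=> acO coreO; split=> [[D dD]|[forestO [L [_ LP]]]].
  (* A default for [nth], never reached at indices below the size. *)
  pose E0 : struct ar := @Struct sig ar void (fun=> set0).
  have dual A : obstr (fun j : 'I_(size D) => nth E0 D j) A <-> exists T, O T /\ hom T A.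
    have inP B : List.In B D <-> exists j : 'I_(size D), nth E0 D j = B.
      split=> [|[[j jD] <-] /=].
        elim: (D) => [//|C s IH] /= [->|/IH[j E]]; first by exists ord0.
        by exists (lift ord0 j).
      elim: (D) j jD => [//|C s IH] [|j] /=; [by left|by move/IH; right].
    have [dA1 dA2] := dD A; split=> [oA|OA j AD].
      by apply: contrapT => /dA2[B /inP[j <-]]; apply: oA.
    by apply: dA1 OA; exists (nth E0 D j) => //; apply/inP; exists j.
  by split; [apply: dual_forest dual|apply: dual_regular dual].
pose E0 : struct ar := @Struct sig ar unit (fun=> set0).
apply: (@regular_dual _ _ O forestO (size L) (fun i => nth (existT _ E0 tt) L i)) => A a fA.
have [p [pL pP]] := LP A a fA.
suff [i E] : exists i : 'I_(size L), nth (existT _ E0 tt) L i = p by exists i; rewrite E.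
elim: (L) pL => [//|q s IH] /= [->|/IH[j E]]; first by exists ord0.
by exists (lift ord0 j).
Qed.
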